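(* Let $0<\alpha<1$, let $f_1,\dots,f_n$ be real-valued functions of $(x_1,\dots,x_n)\in\mathbb{R}^n$, and consider the fractional order system $${}_0^C\mathrm{D}_t^\alpha x_i=f_i(x_1,\dots,x_n),\qquad 1\le i\le n,$$ and its classical counterpart $$\dot x_i=f_i(x_1,\dots,x_n),\qquad 1\le i\le n.$$ The conditions for the invariance of a linear subspace are the same for both systems: a linear subspace $S$ of $\mathbb{R}^n$ is invariant under the fractional order system if and only if it is invariant under the classical system.
   Context: ${}_0^C\mathrm{D}_t^\alpha$ denotes the Caputo fractional derivative: for $0<\alpha<1$, $${}_0^{C}\mathrm{D}_t^\alpha x(t)=\frac{1}{\Gamma(1-\alpha)}\int_0^t (t-\tau)^{-\alpha}x'(\tau)\,d\tau.$$ The vector field $f=(f_1,\dots,f_n)$ is assumed to be of class $C^1$. ''Linear subspace'' is used in the paper's sense of a set of the form $S=\{(x_1,\dots,x_n)\in\mathbb{R}^n:\sum_{i=1}^n a_ix_i=c\}$ with $a_i,c\in\mathbb{R}$. For either system, let $\Phi_t(X_0)$ be its solution with initial value $X(0)=X_0$; a set $S$ is invariant if for every $X_0\in S$ one has $\Phi_t(X_0)\in S$ for all $t$ in the interval of existence of the solution (with $t\ge 0$ for the fractional system). *)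

(* Defs.v *)
(* The real line is an arbitrary R : realType and
   R^n is 'rV[R]_n, with the i-th coordinate of x written x ord0 i. *)
From HB Require Import structures.
From mathcomp Require Import all_boot all_order all_algebra.
From mathcomp Require Import all_classical all_reals all_analysis.

Set Implicit Arguments.
Unset Strict Implicit.
Unset Printing Implicit Defensive.

Import Order.TTheory GRing.Theory Num.Theory.
Import numFieldNormedType.Exports.

Local Open Scope classical_set_scope.
Local Open Scope ring_scope.

(* Only used for z > 0, where the integral converges (otherwise Rintegral
   returns a default value). *)
Definition Gamma (R : realType) (z : R) : R :=
  \int[@lebesgue_measure R]_(t in `]0, +oo[) (t `^ (z - 1) * expR (- t)).

Definition caputo_integrand (R : realType) (alpha : R) (y : R -> R) (t : R)
    : R -> R :=
  fun tau => (t - tau) `^ (- alpha) * derive1 y tau.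

(* Order 0 < alpha < 1, base point 0.  Meaningful when caputo_integrand is
   Lebesgue integrable on ]0, t[, a condition that has to be imposed
   separately.  The end points are left out because y need not be
   differentiable at 0. *)
Definition caputo (R : realType) (alpha : R) (y : R -> R) (t : R) : R :=
  (Gamma (1 - alpha))^-1 *
  \int[@lebesgue_measure R]_(tau in `]0, t[) caputo_integrand alpha y t tau.

Definition of_class_C1 (R : realType) (n : nat) (f : 'rV[R]_n -> 'rV[R]_n) :=
  (forall x, differentiable f x) /\ continuous (fun x => 'J f x).

(* Affine hyperplanes: this is the sense in which "linear subspace" is used.
   The coefficients may all vanish. *)
Definition linear_subspace (R : realType) (n : nat) (S : set 'rV[R]_n) :=
  exists (a : 'I_n -> R) (c : R),
    S = [set x : 'rV[R]_n | \sum_(i < n) a i * x ord0 i = c].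

Definition coordinate (R : realType) (n : nat) (x : R -> 'rV[R]_n) (i : 'I_n)
    : R -> R :=
  fun t => x t ord0 i.

(* x solves the fractional system on [0, T[, where T may be +oo.  Solutions
   are continuous on [0, T[ and C^1 on ]0, T[ only: for f of class C^1 the
   derivative typically blows up like t^(alpha - 1) at 0, and at t = 0 the
   integral defining the Caputo derivative is degenerate, so that the equation
   is imposed for 0 < t < T. *)
Definition fractional_solution (R : realType) (n : nat) (alpha : R)
    (f : 'rV[R]_n -> 'rV[R]_n) (T : \bar R) (x : R -> 'rV[R]_n) :=
  [/\ (0 < T)%E,
      {within [set t : R | 0 <= t /\ (t%:E < T)%E], continuous x} &
      forall t : R, 0 < t -> (t%:E < T)%E -> forall i : 'I_n,
        [/\ derivable (coordinate x i) t 1,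
            {for t, continuous (derive1 (coordinate x i))},
            (@lebesgue_measure R).-integrable `]0, t[
              (EFin \o caputo_integrand alpha (coordinate x i) t) &
            caputo alpha (coordinate x i) t = f (x t) ord0 i]].

(* x solves the classical system on ]a, b[, where a may be -oo and b +oo. *)
Definition classical_solution (R : realType) (n : nat)
    (f : 'rV[R]_n -> 'rV[R]_n) (a b : \bar R) (x : R -> 'rV[R]_n) :=
  [/\ (a < 0)%E, (0 < b)%E &
      forall t : R, (a < t%:E)%E -> (t%:E < b)%E -> forall i : 'I_n,
        is_derive t 1 (coordinate x i) (f (x t) ord0 i)].

(* The intervals are not required to be maximal, but the one of the maximal
   solution Phi_t(X_0) is among them. *)
Definition fractional_invariant (R : realType) (n : nat) (alpha : R)
    (f : 'rV[R]_n -> 'rV[R]_n) (S : set 'rV[R]_n) :=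
  forall (X0 : 'rV[R]_n) (T : \bar R) (x : R -> 'rV[R]_n),
    S X0 -> fractional_solution alpha f T x -> x 0 = X0 ->
    forall t : R, 0 <= t -> (t%:E < T)%E -> S (x t).

Definition classical_invariant (R : realType) (n : nat)
    (f : 'rV[R]_n -> 'rV[R]_n) (S : set 'rV[R]_n) :=
  forall (X0 : 'rV[R]_n) (a b : \bar R) (x : R -> 'rV[R]_n),
    S X0 -> classical_solution f a b x -> x 0 = X0 ->
    forall t : R, (a < t%:E)%E -> (t%:E < b)%E -> S (x t).

(* Main.v *)
(* A hyperplane S = {x | a.x = c} is invariant under either system if and only if
   f is tangent to S, that is a.f = 0 on S.

   Tangency implies invariance: with u = a.x - c, tangency and the local Lipschitz
   property of f give |a.f(x)| <= L |u|.  If |u| is maximal on [s, t] at t and u = 0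
   before s, then the mean value theorem (classical case) or the extremum principle
   (t - s)^(-alpha) |u t| <= |int_s^t (t - r)^(-alpha) u'(r) dr| (fractional case)
   forces u t = 0 as soon as t - s is small; one then advances by small steps.

   Invariance implies tangency: along a local solution starting at X0 in S, a.x is
   constant, so a.f(x(t)) = 0 for small t.  This requires local existence.  For
   the fractional system one iterates on v(t) = t^(1 - alpha) x'(t), which is
   continuous up to 0, via
     v = k (f(X0) + t^alpha int_0^1 (1-r)^(alpha-1) r^(alpha-1) (Df(x) v)(t r) dr).
   Since f is only C1 this map need not be a contraction in v.  But Abel inversion shows
   that the Caputo derivative of the next x is f of the current x, so the extremum
   principle makes the iterates of x contract uniformly; Df(x) then converges uniformly
   and the iterates of v are Cauchy. *)
Require Import Defs.
From mathcomp Require Import all_boot all_order all_algebra.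
From mathcomp Require Import all_classical all_reals all_analysis.
From mathcomp Require Import measurable_realfun.
From mathcomp Require Import lra ring.
Import Order.TTheory GRing.Theory Num.Theory.
Import numFieldNormedType.Exports.
Local Open Scope classical_set_scope.
Local Open Scope ring_scope.

Set Implicit Arguments.
Unset Strict Implicit.
Unset Printing Implicit Defensive.

(** * The fundamental theorem of calculus on an open interval *)

(** A [fractional_solution] must be differentiable on ]0, T[ with an integrable Caputo integrand.
    The usual fixed point of the Volterra equation x(t) = X0 + k int_0^t (t-s)^(alpha-1) f(x(s)) ds,
    taken among continuous functions, gives no derivative. So the unknown is the derivative itself,
    made bounded up to 0 by the weight t^(1-alpha). Differentiating the Volterra equation gives
    x'(t) = k (t^(alpha-1) f(X0) + int_0^t (t-s)^(alpha-1) (f o x)'(s) ds); the chain rule, x' =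
    s^(alpha-1) v and the substitution s = t r turn this into the equation for v. Here k = 1 /
    Gamma(alpha), which appears below as Gamma(1-alpha) / B(1-alpha, alpha). Since the weights are
    singular at both ends of the interval, calculus is done on open intervals, with one-sided limits
    at the ends. *)

Lemma integrable_itv_oo_cc {R : realType} (h : R -> R) (s t : R) :
  (@lebesgue_measure R).-integrable `]s, t[ (EFin \o h) ->
  (@lebesgue_measure R).-integrable `[s, t] (EFin \o h).
Proof.
move=> /integrableP[mh ih]; apply/integrableP; split.
  apply/measurable_EFinP; apply: (@measurable_fun_itv_cc _ _ _ false true).
  exact/measurable_EFinP.
rewrite (integral_itv_bndoo true false)//.
exact: measurableT_comp.
Qed.

Section open_intervals.
Context {R : realType}.
Notation mu := (@lebesgue_measure R).

(** [G - F], with [G] a primitive of [h], has a nonnegative derivative, and its monotonicity passes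
    to the limit at both ends. Only [h] is asked to be integrable, because in the extremum principle
    [dF] carries an extra term of which only the sign is used. *)
Lemma open_FTC_le (h F dF : R -> R) (s t l0 l1 : R) : s < t ->
  mu.-integrable `]s, t[ (EFin \o h) ->
  (forall x, s < x < t -> {for x, continuous h}) ->
  (forall x, s < x < t -> is_derive x 1 F (dF x)) ->
  (forall x, s < x < t -> dF x <= h x) ->
  F x @[x --> s^'+] --> l0 -> F x @[x --> t^'-] --> l1 ->
  l1 - l0 <= \int[mu]_(x in `]s, t[) h x.
Proof.
move=> st ih ch dFF dFh F0 F1.
have ih' := integrable_itv_oo_cc ih.
set G := fun x => \int[mu]_(y in `[s, x]) h y.
have dG x : s < x < t -> is_derive x 1 G (h x).
  move=> xst; have /andP[sx xt] := xst.
  have [dG <-] := continuous_FTC1_closed xt ih' sx (ch _ xst).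
  by rewrite derive1E; exact: derivableP.
have G0 : G x @[x --> s^'+] --> 0.
  apply: cvg_at_right_filter.
  exact: (parameterized_integral_cvg_left st ih').
have G1 : G x @[x --> t^'-] --> G t.
  exact: (parameterized_integral_cvg_at_left st ih').
pose H := G \- F.
have dH x : s < x < t -> is_derive x 1 H (h x - dF x).
  by move=> xst; apply: is_deriveB; [exact: dG|exact: dFF].
have H0 : H x @[x --> s^'+] --> 0 - l0 by exact: cvgB.
have H1 : H x @[x --> t^'-] --> G t - l1 by exact: cvgB.
have ndH a b : s < a -> a < b -> b < t -> H a <= H b.
  move=> sa ab bt.
  have sub x : x \in `[a, b] -> s < x < t.
    by rewrite in_itv/= => /andP[ax xb]; rewrite (lt_le_trans sa)//= (le_lt_trans xb).
  have [||c cab] := @MVT _ H (fun x => h x - dF x) _ _ ab.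
  - by move=> x xab; apply: dH; apply: sub; exact: subset_itv_oo_cc.
  - apply: derivable_within_continuous => x /sub xst.
    by have [] := dH _ xst.
  move=> e; rewrite -subr_ge0 e mulr_ge0// ?subr_ge0 ?(ltW ab)// dFh// sub//.
  exact: subset_itv_oo_cc.
have H1' a : s < a -> a < t -> H a <= G t - l1.
  move=> sa at'; apply: (cvgr_to_ge H1); near=> b.
  apply: ndH; first exact: sa.
    by near: b; exact: nbhs_left_gt.
  by near: b; exact: nbhs_left_lt.
have : - l0 <= G t - l1.
  rewrite -[leLHS]add0r; apply: (cvgr_to_le H0); near=> a.
  apply: H1'.
    by near: a; exact: nbhs_right_gt.
  by near: a; exact: nbhs_right_lt.
rewrite (_ : \int[mu]_(x in `]s, t[) h x = G t); first lra.
rewrite /G /Rintegral (integral_itv_bndoo true false)//.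
by case/integrableP : ih.
Unshelve. all: by end_near. Qed.

Lemma open_FTC (h F : R -> R) (s t l0 l1 : R) : s < t ->
  mu.-integrable `]s, t[ (EFin \o h) ->
  (forall x, s < x < t -> {for x, continuous h}) ->
  (forall x, s < x < t -> is_derive x 1 F (h x)) ->
  F x @[x --> s^'+] --> l0 -> F x @[x --> t^'-] --> l1 ->
  \int[mu]_(x in `]s, t[) h x = l1 - l0.
Proof.
move=> st ih ch dF F0 F1; apply/eqP; rewrite eq_le; apply/andP; split; last first.
  exact: (open_FTC_le st ih ch dF).
have ihN : mu.-integrable `]s, t[ (EFin \o (- h)) by exact: integrableN ih.
have := @open_FTC_le (- h) (- F) (- h) s t (- l0) (- l1) st ihN.
rewrite (_ : \int[mu]_(x in `]s, t[) (- h) x = - \int[mu]_(x in `]s, t[) h x); last first.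
  transitivity (\int[mu]_(x in `]s, t[) (-1 * h x)).
    by apply: eq_Rintegral => x _ /=; rewrite mulN1r.
  by rewrite RintegralZl// mulN1r.
move=> H; suff : - l1 - - l0 <= - \int[mu]_(x in `]s, t[) h x by lra.
apply: H => //.
- by move=> x xst; apply: cvgN; exact: ch.
- by move=> x xst; apply: is_deriveN; exact: dF.
- exact: cvgN.
- exact: cvgN.
Qed.

End open_intervals.

(** * The extremum principle *)

Section ext.
Context {R : realType}.
Notation mu := (@lebesgue_measure R).
(* The extremum principle for the Caputo derivative: integrating by parts moves
   the derivative onto the increasing weight (t - x)^(-alpha). *)
Lemma weighted_derive_ge_increment (alpha : R) (u du : R -> R) (s t : R) :
  0 < alpha < 1 -> s < t ->
  {within `[s, t], continuous u} ->
  (forall x, s < x <= t -> is_derive x 1 u (du x)) ->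
  (forall x, s < x < t -> {for x, continuous du}) ->
  mu.-integrable `]s, t[ (EFin \o (fun x => (t - x) `^ (- alpha) * du x)) ->
  (forall x, s <= x <= t -> u x <= u t) ->
  (t - s) `^ (- alpha) * (u t - u s) <=
    \int[mu]_(x in `]s, t[) ((t - x) `^ (- alpha) * du x).
Proof.
move=> /andP[a0 a1] st cu du_u cdu iu maxu.
have dm x : x < t -> is_derive x 1 (fun x => (t - x) `^ (- alpha))
    (alpha * (t - x) `^ (- alpha - 1)).
  move=> xt.
  have tx : 0 < t - x by rewrite subr_gt0.
  have := @is_derive1_comp R (fun y => y `^ (- alpha)) (fun x => t - x) x _ _
    (is_derive1_powR (- alpha) tx)
    (is_deriveB (is_derive_cst t x 1) (is_derive_id x 1)).
  by move=> h; apply: is_derive_eq h _; ring.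
(* Subtracting the maximal value [u t] does two things: the derivative of the weight gets multiplied
   by [u x - u t <= 0], and [F] tends to 0 at t in spite of the singular weight. *)
pose F x := (t - x) `^ (- alpha) * (u x - u t).
rewrite (_ : (t - s) `^ (- alpha) * (u t - u s) = 0 - F s); last by rewrite /F; ring.
apply: (open_FTC_le (F := F) (dF := fun x =>
   (t - x) `^ (- alpha) * du x + (u x - u t) * (alpha * (t - x) `^ (- alpha - 1)))) => //.
- move=> x /andP[sx xt]; apply: cvgM; last by apply: cdu; rewrite sx.
  by have [/derivable1_diffP/differentiable_continuous + _] := dm _ xt.
- move=> x /andP[sx xt]; rewrite /F.
  have dux := du_u x; rewrite sx ltW// in dux; have {}dux := dux isT.
  have := is_deriveM (dm _ xt) (is_deriveB dux (is_derive_cst (u t) x 1)).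
  by move=> h; apply: is_derive_eq h _; rewrite /= subr0 -!/(GRing.scale _ _).
- move=> x /andP[sx xt]; rewrite gerDl mulr_le0_ge0//.
    by rewrite subr_le0 maxu// !ltW.
  by rewrite mulr_ge0 ?powR_ge0// ltW.
- apply: cvgM.
    apply: cvg_at_right_filter.
    by have [/derivable1_diffP/differentiable_continuous + _] := dm _ st.
  apply: cvgB; last exact: cvg_cst.
  by have /(continuous_within_itvP _ st)[] := cu.
- have dut : is_derive t 1 u (du t) by apply: du_u; rewrite st lexx.
  have shift : x - t @[x --> t^'-] --> 0^'.
    move=> A [e /= e0 eA]; change (\forall x \near t^'-, A (x - t)).
    near=> x; apply: eA => /=.
      rewrite sub0r normrN distrC ger0_norm ?subr_ge0; last first.
        by near: x; exact: nbhs_left_le.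
      by rewrite ltrBlDl -ltrBlDr; near: x; apply: nbhs_left_gt; lra.
    by rewrite subr_eq0 lt_eqF//; near: x; exact: nbhs_left_lt.
  have q : (u x - u t) / (x - t) @[x --> t^'-] --> du t.
    have [/cvg_ex[/= l dl] dE] := dut.
    have {}dE : du t = l by rewrite -dE; exact: cvg_lim dl.
    rewrite dE; apply: cvg_trans (cvg_comp _ _ shift dl).
    apply: near_eq_cvg; near=> x => /=.
    by rewrite /GRing.scale/= mulr1 subrK mulrC.
  have -> : 0 = 0 * (- du t) by rewrite mul0r.
  (* Near t, [F] is minus a difference quotient of [u] times (t - x)^(1 - alpha); the power tends to
     0 because alpha < 1. *)
  have : (t - x) `^ (1 - alpha) * - ((u x - u t) / (x - t)) @[x --> t^'-] --> 0 * (- du t).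
    apply: cvgM; last exact: cvgN.
    apply: (cvg_comp (fun x => t - x) (fun y => y `^ (1 - alpha))); last first.
      by apply: powR_cvg0; lra.
    move=> A [e /= e0 eA]; change (\forall x \near t^'-, A (t - x)).
    near=> x; apply: eA => /=; last first.
      by rewrite subr_gt0; near: x; exact: nbhs_left_lt.
    rewrite sub0r normrN ger0_norm ?subr_ge0; last first.
      by near: x; exact: nbhs_left_le.
    by rewrite ltrBlDl -ltrBlDr; near: x; apply: nbhs_left_gt; lra.
  apply: cvg_trans; apply: near_eq_cvg; near=> x.
  have xt : x < t by near: x; exact: nbhs_left_lt.
  have tx : t - x != 0 by rewrite gt_eqF// subr_gt0.
  rewrite /F powRD ?tx ?implybT//.
  rewrite powRr1 ?subr_ge0 ?(ltW xt)//.
  by field; lra.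
Unshelve. all: by end_near. Qed.
End ext.

(** * Vector-valued maps of class C1 *)

Section vector_calculus.
Context {R : realType}.

Lemma norm_coord_le m n (x : 'M[R]_(m, n)) i j : `|x i j| <= `|x|.
Proof.
rewrite [leRHS]/Num.norm /= mx_normrE.
by apply/bigmax_geP; right => /=; exists (i, j).
Qed.

Lemma norm_le_coord m n (x : 'M[R]_(m, n)) e : 0 <= e ->
  (forall i j, `|x i j| <= e) -> `|x| <= e.
Proof.
move=> e0 xe; rewrite [leLHS]/Num.norm /= mx_normrE.
by apply: bigmax_le => // -[i j] _; exact: xe.
Qed.

Lemma norm_mulmx_coord_le n (x : 'rV[R]_n) (A : 'M[R]_n) a b i :
  `|x| <= a -> (forall i j, `|A i j| <= b) -> `|(x *m A) ord0 i| <= n%:R * (a * b).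
Proof.
move=> xa Ab; rewrite mxE (le_trans (ler_norm_sum _ _ _))//.
rewrite -[n in n%:R]card_ord mulr_natl -sumr_const ler_sum// => j _.
rewrite normrM ler_pM//; apply: le_trans xa; exact: norm_coord_le.
Qed.

Lemma compact_ball_rV n (X : 'rV[R]_n) r : compact [set p | `|p - X| <= r].
Proof.
apply: bounded_closed_compact.
  exists (r + `|X|); split; first exact: num_real.
  move=> M rM p /= pX; apply: le_trans (ltW rM).
  by rewrite -[p in leLHS](subrK X) (le_trans (ler_normD _ _))// lerD2r.
rewrite (_ : [set p | _] = (fun p => `|p - X|) @^-1` [set x | x <= r])//.
apply: closed_comp; last exact: closed_le.
move=> p _; apply: continuous_comp; last exact: norm_continuous.
by apply: (@continuousB _ _ _ id (cst X)); [exact: cvg_id|exact: cst_continuous].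
Qed.

Lemma compact_bounded_image (V W : normedModType R) (K : set V) (g : V -> W) :
  compact K -> continuous g -> exists2 M, 0 < M & forall p, K p -> `|g p| <= M.
Proof.
move=> cK cg.
have [M [_ /(_ (Num.max M 0 + 1))]] : bounded_set (g @` K).
  by apply: compact_bounded; apply: continuous_compact => //; exact: continuous_subspaceT.
rewrite ltr_pwDr ?le_max ?lexx// => /(_ isT) gM.
exists (Num.max M 0 + 1); first by rewrite ltr_pwDr// le_max lexx orbT.
by move=> p Kp; apply: gM; exists p.
Qed.

(** Near-covering compactness makes [d] uniform: a radius [r] good at x is split into r/2 for p
    around x and r/2 for q around p. Only p has to lie in [K]. *)
Lemma compact_uniformly_continuous (V W : normedModType R) (K : set V) (g : V -> W) :
  compact K -> continuous g -> forall e, 0 < e -> exists2 d, 0 < d &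
    forall p q, K p -> `|p - q| < d -> `|g p - g q| <= e.
Proof.
move=> /compact_near_coveringP cK cg e e0.
pose P d x := forall q, `|x - q| < d -> `|g x - g q| <= e.
have /(cK _ 0^'+ P _) : forall x, K x -> \forall x' \near x & d \near 0^'+, P d x'.
  move=> x Kx; have /cvgrPdist_lt/(_ (e / 2)) := cg x.
  rewrite divr_gt0// => /(_ isT) /nbhs_normP[r /= r0 gr].
  exists (ball x (r / 2), [set d | d < r / 2]); first split => /=.
  - by apply: nbhsx_ballx; rewrite divr_gt0.
  - by apply: nbhs_right_lt; rewrite divr_gt0.
  move=> [x' d] /= [xx' dr] q x'q.
  rewrite -ball_normE /= in xx'.
  have gx' : `|g x - g x'| < e / 2 by apply: gr; rewrite /=; lra.
  have gq : `|g x - g q| < e / 2.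
    apply: gr; rewrite /= -[x](subrK x') -addrA (le_lt_trans (ler_normD _ _))//.
    by lra.
  rewrite -[g x'](subrK (g x)) -addrA (le_trans (ler_normD _ _))// distrC.
  by lra.
move=> KP; have [d] := @filter_ex _ 0^'+ _ _ (filterI KP (nbhs_right_gt 0)).
by move=> [KPd d0]; exists d => // p q Kp; exact: KPd.
Qed.

Lemma is_derive_comp_C1 n (f : 'rV[R]_n -> 'rV[R]_n) (g : R -> 'rV[R]_n)
    (v : 'rV[R]_n) (t : R) :
  (forall p, differentiable f p) ->
  (forall i, is_derive t 1 (fun s => g s ord0 i) (v ord0 i)) ->
  forall j, is_derive t 1 (fun s => f (g s) ord0 j) ((v *m 'J f (g t)) ord0 j).
Proof.
move=> df dg j.
have dgt : derivable g t 1.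
  by apply/derivable_mxP => i k; rewrite (ord1 i); have [] := dg k.
have Dg : 'D_1 g t = v.
  by rewrite derive_mx//; apply/rowP => k; rewrite mxE; have [_ ->] := dg k.
have dg' : differentiable g t by exact/derivable1_diffP.
have dfg : differentiable (f \o g) t by exact: differentiable_comp.
have dfg' : derivable (f \o g) t 1 by exact/derivable1_diffP.
have Dfg : 'D_1 (f \o g) t = v *m 'J f (g t).
  transitivity ('d f (g t) ('d g t 1)).
    transitivity ('d (f \o g) t 1); first exact: deriveE.
    have e := @diff_comp R R _ _ g f t dg' (df (g t)).
    exact: (congr1 (fun h : R -> 'rV[R]_n => h 1) e).
  have -> : 'd g t 1 = v by rewrite -Dg; apply/esym; exact: deriveE.
  transitivity ('D_v f (g t)); first by apply/esym; exact: deriveE.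
  exact: deriveEjacobian.
apply: DeriveDef; first exact: (derivable_mxP _ _ _).1.
by rewrite -Dfg derive_mx// mxE.
Qed.

(** The mean value theorem is applied to each coordinate of f along the segment from q to p, which
    stays in the ball by convexity. *)
Lemma lipschitz_of_jacobian n (f : 'rV[R]_n -> 'rV[R]_n) (X : 'rV[R]_n) (r b : R) :
  (forall p, differentiable f p) -> 0 <= b ->
  (forall p, `|p - X| <= r -> forall i j, `|'J f p i j| <= b) ->
  forall p q, `|p - X| <= r -> `|q - X| <= r ->
    `|f p - f q| <= n%:R * b * `|p - q|.
Proof.
move=> df b0 Jb p q pX qX.
apply: norm_le_coord => [|i j]; first by rewrite !mulr_ge0.
rewrite (ord1 i) {i} !mxE.
pose g (s : R) := q + s *: (p - q).
have dg (s : R) i : is_derive s 1 (fun s => g s ord0 i) ((p - q) ord0 i).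
  rewrite (_ : (fun s => _) = (fun s => q ord0 i + (p - q) ord0 i * s)); last first.
    by apply/funext => s'; rewrite !mxE; ring.
  have := is_deriveD (is_derive_cst (q ord0 i) s (1 : R))
    (is_deriveZ ((p - q) ord0 i) (is_derive_id s 1)).
  by move=> h; apply: is_derive_eq h _; rewrite add0r /GRing.scale/= mulr1.
have dfg (s : R) := is_derive_comp_C1 df (dg s) j.
have [|c] := @MVT R (fun s => f (g s) ord0 j) _ 0 1 ltr01 (fun s _ => dfg s).
  by apply: derivable_within_continuous => s _; have [] := dfg s.
rewrite in_itv/= => /andP[c0 c1].
rewrite {1 2}/g scale1r scale0r addr0 subr0 mulr1 (addrC q) subrK => ->.
rewrite -mulrA [b * _]mulrC; apply: norm_mulmx_coord_le => //.
apply: Jb; rewrite (_ : g c - X = (1 - c) *: (q - X) + c *: (p - X)); last first.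
  by apply/rowP => k; rewrite !mxE; ring.
rewrite (le_trans (ler_normD _ _))// !normrZ !gtr0_norm ?subr_gt0//.
rewrite (_ : r = (1 - c) * r + c * r); last by ring.
by rewrite lerD// ler_wpM2l// ltW// subr_gt0.
Qed.
End vector_calculus.

(** * Tangency to a hyperplane *)

Section invariance.
Context {R : realType}.
Notation mu := (@lebesgue_measure R).

(** If u vanishes up to s = k d and x lies at most d further, then |u| attains its maximum over
    [s, x] at some m. The hypothesis on [s, m] gives u m = 0, so u vanishes up to x. *)
Lemma eq0_of_local_maxima (u : R -> R) (b d : R) : 0 < d ->
  {within `[0, b], continuous u} -> u 0 = 0 ->
  (forall s t, 0 <= s -> s < t -> t <= b -> t - s <= d ->
    (forall x, 0 <= x <= s -> u x = 0) ->
    (forall x, s <= x <= t -> `|u x| <= `|u t|) -> u t = 0) ->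
  forall x, 0 <= x <= b -> u x = 0.
Proof.
move=> d0 cu u0 step.
have claim (k : nat) x : 0 <= x <= b -> x <= k%:R * d -> u x = 0.
  elim: k x => [|k ih] x /andP[x0 xb].
    by rewrite mul0r => x0'; rewrite (_ : x = 0)//; apply/eqP; rewrite eq_le x0 x0'.
  rewrite -natr1 mulrDl mul1r => xk.
  have [|sx] := leP x (k%:R * d); first by apply: ih; rewrite x0.
  set s := k%:R * d in ih sx xk.
  have s0 : 0 <= s by rewrite mulr_ge0// ltW.
  have us y : 0 <= y <= s -> u y = 0.
    move=> /andP[y0 ys]; apply: ih => //.
    by rewrite y0 (le_trans ys)// (le_trans (ltW sx)).
  have cnu : {within `[s, x], continuous (fun y => `|u y|)}.
    have : {within `[s, x], continuous u}.
      apply: continuous_subspaceW cu => y /=; rewrite !in_itv/= => /andP[sy yx].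
      by rewrite (le_trans s0)//= (le_trans yx).
    by move=> cu' y; apply: continuous_comp; [exact: cu'|exact: norm_continuous].
  have [m + maxm] := EVT_max (ltW sx) cnu.
  rewrite in_itv/= => /andP[sm mx].
  have um0 : u m = 0.
    move: sm; rewrite le_eqVlt => /predU1P[<-|sm]; first by rewrite us// s0 lexx.
    apply: (step s m) => //.
    - exact: le_trans xb.
    - by lra.
    - move=> y /andP[sy ym]; apply: maxm.
      by rewrite in_itv/= sy (le_trans ym).
  have := maxm x; rewrite in_itv/= lexx (ltW sx) um0 normr0 => /(_ isT).
  by rewrite normr_le0 => /eqP.
move=> x xb; apply: (claim (Num.bound (x / d))) => //.
rewrite -ler_pdivrMr// ltW//; apply: archi_boundP.
by case/andP : xb => x0 _; rewrite divr_ge0// ltW.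
Qed.

Definition dot n (a : 'I_n -> R) (x : 'rV[R]_n) := \sum_(i < n) a i * x ord0 i.

Lemma dotB n (a : 'I_n -> R) x y : dot a (x - y) = dot a x - dot a y.
Proof.
rewrite /dot -sumrB; apply: eq_bigr => i _; by rewrite !mxE mulrBr.
Qed.

Lemma dotZ n (a : 'I_n -> R) k x : dot a (k *: x) = k * dot a x.
Proof.
rewrite /dot mulr_sumr; apply: eq_bigr => i _; by rewrite !mxE mulrCA.
Qed.

Lemma norm_dot_le n (a : 'I_n -> R) x :
  `|dot a x| <= (\sum_(i < n) `|a i|) * `|x|.
Proof.
rewrite (le_trans (ler_norm_sum _ _ _))// mulr_suml ler_sum// => i _.
by rewrite normrM ler_wpM2l// norm_coord_le.
Qed.

Lemma continuous_dot n (a : 'I_n -> R) : continuous (dot a).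
Proof.
apply: continuous_big => [|i _ x]; first exact: add_continuous.
by apply: (@continuousM _ _ (cst (a i))); [exact: cst_continuous|exact: coord_continuous].
Qed.

Lemma C1_jacobian_bounded n (f : 'rV[R]_n -> 'rV[R]_n) X r : of_class_C1 f ->
  exists2 b, 0 <= b &
    forall p, `|p - X| <= r -> forall i j, `|'J f p i j| <= b.
Proof.
move=> [_ cJ]; have [b b0 Jb] := compact_bounded_image (compact_ball_rV (X := X) (r := r)) cJ.
exists b; first exact: ltW.
by move=> p pX i j; rewrite (le_trans (norm_coord_le _ _ _))// Jb.
Qed.

Lemma C1_lipschitz_ball n (f : 'rV[R]_n -> 'rV[R]_n) X r : of_class_C1 f ->
  exists2 L, 0 <= L & forall p q, `|p - X| <= r -> `|q - X| <= r ->
    `|f p - f q| <= L * `|p - q|.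
Proof.
move=> C1f; have [b b0 Jb] := C1_jacobian_bounded X r C1f.
exists (n%:R * b); first by rewrite mulr_ge0.
by apply: lipschitz_of_jacobian => //; case: C1f.
Qed.

Definition tangent n (f : 'rV[R]_n -> 'rV[R]_n) (a : 'I_n -> R) (c : R) :=
  forall x, dot a x = c -> dot a (f x) = 0.

(** Let q be the orthogonal projection of p onto the hyperplane. Tangency gives a.f(q) = 0, so
    a.f(p) = a.(f(p) - f(q)) is controlled by |p - q|, which is proportional to |a.p - c|. *)
Lemma tangent_normal_component n (f : 'rV[R]_n -> 'rV[R]_n) a c M :
  of_class_C1 f -> tangent f a c -> exists2 L, 0 <= L &
    forall p, `|p| <= M -> `|dot a (f p)| <= L * `|dot a p - c|.
Proof.
move=> C1f tan; pose av := \row_i a i; pose A := dot a av.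
have A0 : 0 <= A.
  by apply: sumr_ge0 => i _; rewrite mxE -expr2 sqr_ge0.
(* With all coefficients zero there is no normal direction to project along, but then [dot a]
   vanishes identically. *)
have [Aeq0|An0] := eqVneq A 0.
  exists 0 => // p _; rewrite mul0r normr_le0; apply/eqP.
  have a0 i : a i = 0.
    move/eqP: Aeq0; rewrite psumr_eq0; last by move=> k _; rewrite mxE -expr2 sqr_ge0.
    by move=> /allP/(_ i); rewrite mem_index_enum mxE => /(_ isT)/eqP/eqP; rewrite mulf_eq0 orbb => /eqP.
  by rewrite /dot big1// => i _; rewrite a0 mul0r.
pose S := \sum_(i < n) `|a i|.
(* Large enough for the ball to contain p and its projection, since |a.p - c| <= S M + |c|. *)
pose r := M + (S * M + `|c|) / A * `|av|.
have [L L0 fL] := C1_lipschitz_ball 0 r C1f.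
exists (S * L * `|av| / A).
  by rewrite !mulr_ge0// ?invr_ge0// sumr_ge0.
move=> p pM; pose k := (dot a p - c) / A; pose q := p - k *: av.
have dq : dot a (f q) = 0 by apply: tan; rewrite dotB dotZ -/A divfK//; ring.
have kle : `|k| <= (S * M + `|c|) / A.
  rewrite normrM normfV (ger0_norm A0) ler_wpM2r ?invr_ge0//.
  rewrite (le_trans (ler_normB _ _))// lerD2r (le_trans (norm_dot_le _ _))//.
  by rewrite ler_wpM2l// sumr_ge0.
rewrite -[dot a (f p)]subr0 -dq -dotB (le_trans (norm_dot_le _ _))//.
rewrite -!mulrA ler_wpM2l ?sumr_ge0//.
rewrite (le_trans (fL _ _ _ _))//.
- rewrite subr0 (le_trans pM)// lerDl mulr_ge0// (le_trans _ kle)//.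
- rewrite subr0 (le_trans (ler_normB _ _))// lerD// normrZ ler_wpM2r//.
- rewrite ler_wpM2l// opprB addrC subrK normrZ /k normrM normfV (ger0_norm A0).
  by rewrite le_eqVlt; apply/orP; left; apply/eqP; ring.
Qed.

Lemma integrable_EFinZl d (T : measurableType d) (nu : {measure set T -> \bar R})
    (D : set T) (g : T -> R) k : measurable D -> nu.-integrable D (EFin \o g) ->
  nu.-integrable D (EFin \o (fun x => k * g x)).
Proof.
by move=> mD /(integrableZl mD k); apply: eq_integrable.
Qed.

Lemma Rintegral_sum_ord d (T : measurableType d) (nu : {measure set T -> \bar R})
    n (D : set T) (g : 'I_n -> T -> R) : measurable D ->
  (forall i, nu.-integrable D (EFin \o g i)) ->
  nu.-integrable D (EFin \o (fun x => \sum_(i < n) g i x)) /\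
  \int[nu]_(x in D) (\sum_(i < n) g i x) = \sum_(i < n) \int[nu]_(x in D) g i x.
Proof.
move=> mD ig; elim: n g ig => [|n ih] g ig.
  split; last by under eq_Rintegral do rewrite big_ord0; rewrite big_ord0 Rintegral_cst// mul0r.
  apply: (@eq_integrable _ _ _ nu D mD (cst 0%E)); last exact: integrable0.
  by move=> x _; rewrite /= big_ord0.
have [ihg es] := ih (fun i => g (widen_ord (leqnSn n) i)) (fun i => ig _).
split.
  have := integrableD mD ihg (ig ord_max); apply: eq_integrable => // x _ /=.
  by rewrite big_ord_recr/= EFinD.
under eq_Rintegral do rewrite big_ord_recr/=.
by rewrite RintegralD// es big_ord_recr.
Qed.

(** By linearity the scalar function a.x obeys a Caputo equation of its own, with right-hand side
    a.f(x). The factor Gamma(1 - alpha) is cleared so that the bare integral matches the one in the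
    extremum principle. *)
Lemma fractional_solution_dot n alpha (f : 'rV[R]_n -> 'rV[R]_n) T x a t :
  0 < Gamma (1 - alpha) ->
  fractional_solution alpha f T x -> 0 < t -> (t%:E < T)%E ->
  let h s := (t - s) `^ (- alpha) * \sum_(i < n) a i * derive1 (coordinate x i) s in
  mu.-integrable `]0, t[ (EFin \o h) /\
  \int[mu]_(s in `]0, t[) h s = Gamma (1 - alpha) * dot a (f (x t)).
Proof.
move=> G0 [_ _ solx] t0 tT h.
pose g i s := a i * caputo_integrand alpha (coordinate x i) t s.
have ig i : mu.-integrable `]0, t[ (EFin \o g i).
  by have [_ _ ii _] := solx t t0 tT i; exact: integrable_EFinZl.
have [//|ih eh] := Rintegral_sum_ord (nu := mu) _ ig.
have hE : h = (fun s => \sum_(i < n) g i s).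
  apply/funext => s; rewrite /h mulr_sumr; apply: eq_bigr => i _.
  by rewrite /g /caputo_integrand mulrCA.
rewrite hE; split => //; rewrite eh /dot mulr_sumr; apply: eq_bigr => i _.
have [_ _ ii] := solx t t0 tT i.
rewrite /caputo /g RintegralZl// => <-.
by rewrite [RHS]mulrCA mulVKf ?gt_eqF.
Qed.
End invariance.

(** * Tangency implies invariance *)

Section invariance.
Context {R : realType}.
Notation mu := (@lebesgue_measure R).

Lemma segment_bounded_path (V : normedModType R) (x : R -> V) t :
  {within `[0, t], continuous x} ->
  exists M, forall s, 0 <= s <= t -> `|x s| <= M.
Proof.
move=> cx; have [M [_ /(_ (M + 1))]] : bounded_set (x @` `[0, t]).
  by apply: compact_bounded; apply: continuous_compact => //; exact: segment_compact.
rewrite ltrDl ltr01 => /(_ isT) xM; exists (M + 1) => s st; apply: xM.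
by exists s => //=; rewrite in_itv.
Qed.

Lemma within_continuous_dot n (a : 'I_n -> R) c (x : R -> 'rV[R]_n) A :
  {within A, continuous x} -> {within A, continuous (fun s => dot a (x s) - c)}.
Proof.
move=> cx s; apply: (@continuousB _ _ _ (fun s : subspace A => dot a (x s)) (cst c)).
  by apply: continuous_comp; [exact: cx|exact: continuous_dot].
exact: cst_continuous.
Qed.

Lemma is_derive_dot n (a : 'I_n -> R) c (x : R -> 'rV[R]_n) (v : 'I_n -> R) (s : R) :
  (forall i, is_derive s 1 (coordinate x i) (v i)) ->
  is_derive s 1 (fun s => dot a (x s) - c) (\sum_(i < n) a i * v i).
Proof.
move=> dx; rewrite -[\sum_(i < n) _]subr0.
apply: (@is_deriveB _ _ _ (fun s => dot a (x s)) (cst c)).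
rewrite /dot (_ : (fun s => _) = \sum_(i < n) (fun s => a i * coordinate x i s)).
  by apply: is_derive_sum => i; exact: is_deriveZ.
by apply/funext => r; rewrite fct_sumE.
Qed.

(** The factor [e] serves both time directions: s |-> x(- s) solves the system for - f, so negative
    times are reached with e = -1. *)
Lemma tangent_forward_invariant n (f : 'rV[R]_n -> 'rV[R]_n) a c
    (e t : R) (x : R -> 'rV[R]_n) :
  of_class_C1 f -> tangent f a c -> `|e| <= 1 -> 0 <= t -> dot a (x 0) = c ->
  (forall s, 0 <= s <= t -> forall i,
    is_derive s 1 (coordinate x i) (e * f (x s) ord0 i)) ->
  dot a (x t) = c.
Proof.
move=> C1f tan e1 t0 x0 dx.
have cx : {within `[0, t], continuous x}.
  apply: derivable_within_continuous => s; rewrite in_itv => st.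
  by apply/derivable_mxP => i j; rewrite (ord1 i); have [] := dx _ st j.
have [M xM] := segment_bounded_path cx.
have [L L0 tanL] := tangent_normal_component M C1f tan.
pose u s := dot a (x s) - c.
have du s : 0 <= s <= t -> is_derive s 1 u (e * dot a (f (x s))).
  move=> st; apply: is_derive_eq (is_derive_dot a c (dx _ st)) _.
  by rewrite /dot mulr_sumr; apply: eq_bigr => i _; rewrite mulrCA.
suff : u t = 0 by move=> /eqP; rewrite subr_eq0 => /eqP.
(* On steps of this length the mean value theorem gives |u r| <= L |u r| / (2 (L + 1)) <= |u r| /
   2. *)
have d0 : 0 < (2 * (L + 1))^-1 by rewrite invr_gt0; lra.
apply: (eq0_of_local_maxima d0 (b := t)); last by rewrite t0 lexx.
- exact: within_continuous_dot.
- by rewrite /u x0 subrr.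
move=> s r s0 sr rt srd us umax.
have sub z : z \in `[s, r] -> 0 <= z <= t.
  by rewrite in_itv/= => /andP[sz zr]; rewrite (le_trans s0)//= (le_trans zr).
have [||z zsr] := @MVT R u (fun s => e * dot a (f (x s))) _ _ sr.
- by move=> z zsr; apply: du; apply: sub; exact: subset_itv_oo_cc.
- by apply: derivable_within_continuous => z /sub/du[].
rewrite (us s) ?s0 ?lexx// subr0 => urE.
have zsr' := sub _ (subset_itv_oo_cc zsr).
have : `|u r| <= L * `|u r| * (2 * (L + 1))^-1.
  rewrite {1}urE normrM (ger0_norm (_ : 0 <= r - s)); last by lra.
  rewrite ler_pM//; first by lra.
  rewrite normrM -[leRHS]mul1r ler_pM//.
  rewrite (le_trans (tanL _ (xM _ zsr')))// ler_wpM2l// umax//.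
  by move: zsr; rewrite in_itv/= => /andP[/ltW -> /ltW ->].
move=> ur; apply/normr0_eq0/eqP; rewrite eq_le normr_ge0 andbT.
have : L * (2 * (L + 1))^-1 <= 2^-1 by rewrite ler_pdivrMr; lra.
rewrite mulrAC in ur; have := normr_ge0 (u r); nra.
Qed.

Lemma classical_invariant_of_tangent n (f : 'rV[R]_n -> 'rV[R]_n) a c :
  of_class_C1 f -> tangent f a c -> classical_invariant f [set x | dot a x = c].
Proof.
move=> C1f tan X0 l b x SX0 [l0 b0 dx] x0 t lt tb /=.
have [t0|t0] := leP 0 t.
  apply: (tangent_forward_invariant (e := 1) C1f tan) => //.
  - by rewrite normr1.
  - by rewrite x0.
  move=> s /andP[s0 st] i; rewrite mul1r; apply: dx.
    by rewrite (lt_le_trans l0)// lee_fin.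
  by rewrite (le_lt_trans _ tb)// lee_fin.
have := @tangent_forward_invariant n f a c (-1) (- t) (fun s => x (- s)) C1f tan.
rewrite opprK; apply => //.
- by rewrite normrN1.
- by rewrite oppr_ge0 ltW.
- by rewrite oppr0 x0.
move=> s /andP[s0 st] i.
have dxs : is_derive (- s) 1 (coordinate x i) (f (x (- s)) ord0 i).
  apply: dx; first by rewrite (lt_le_trans lt)// lee_fin; lra.
  by rewrite (le_lt_trans _ b0)// lee_fin; lra.
have h := @is_derive1_comp R (coordinate x i) (fun s => - s) s _ _ dxs
  (is_deriveN (is_derive_id s 1)).
by apply: is_derive_eq h _; rewrite mulrC.
Qed.

(** A solution restarted at s > 0 need not be a solution, since the Caputo integral remembers all
    times from 0 on. Small steps still work: [u] vanishes up to s, so the integral over ]0,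
    r[ reduces to the one over ]s, r[. *)
Lemma fractional_invariant_of_tangent n alpha (f : 'rV[R]_n -> 'rV[R]_n) a c :
  0 < alpha < 1 -> 0 < Gamma (1 - alpha) ->
  of_class_C1 f -> tangent f a c ->
  fractional_invariant alpha f [set x | dot a x = c].
Proof.
move=> a01 G0 C1f tan X0 T x SX0 solx x0 t t0 tT /=.
have [_ cx dx] := solx.
have ltT s : s <= t -> (s%:E < T)%E.
  by move=> st; rewrite (le_lt_trans _ tT)// lee_fin.
have {}cx : {within `[0, t], continuous x}.
  apply: continuous_subspaceW cx => s /=; rewrite in_itv/= => /andP[s0 st].
  by split => //; exact: ltT.
have [M xM] := segment_bounded_path cx.
have [L L0 tanL] := tangent_normal_component M C1f tan.
pose u s := dot a (x s) - c.
pose du s := \sum_(i < n) a i * derive1 (coordinate x i) s.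
have duP s : 0 < s <= t -> is_derive s 1 u (du s).
  move=> /andP[s0 st]; apply: is_derive_dot => i.
  have [+ _ _ _] := dx s s0 (ltT _ st) i.
  by rewrite derive1E; exact: derivableP.
have cdu s : 0 < s <= t -> {for s, continuous du}.
  move=> /andP[s0 st]; apply: cvg_big => [|i _]; first exact: add_continuous.
  have [_ cdx _ _] := dx s s0 (ltT _ st) i.
  by apply: cvgM => //; exact: cvg_cst.
suff : u t = 0 by move=> /eqP; rewrite subr_eq0 => /eqP.
set G := Gamma (1 - alpha) in G0.
have K0 : 0 < G * L + 1 by rewrite ltr_wpDl// mulr_ge0// ltW.
have a0 : 0 < alpha by case/andP : a01.
(* Chosen so that d^(-alpha) = G L + 1. The extremum principle and tangency give (r - s)^(-alpha) |u
   r| <= G L |u r|, while r - s <= d makes the left side at least (G L + 1) |u r|; this forces u r =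
   0. *)
pose d := (G * L + 1) `^ (- alpha^-1).
have d0 : 0 < d by rewrite powR_gt0.
have dE : d `^ (- alpha) = G * L + 1.
  by rewrite /d -powRrM mulrNN mulVf ?gt_eqF// powRr1// ltW.
apply: (eq0_of_local_maxima d0 (b := t)); last by rewrite t0 lexx.
- exact: within_continuous_dot.
- by rewrite /u x0 SX0 subrr.
move=> s r s0 sr rt srd us umax.
have r0 : 0 < r by exact: le_lt_trans sr.
have sub z : s <= z <= r -> 0 <= z <= t by move=> szr; lra.
have sub' z : s < z <= r -> 0 < z <= t by move=> szr; lra.
have sub'' z : s < z < r -> 0 < z <= t by move=> szr; lra.
have rt' : 0 <= r <= t by lra.
apply: contrapT => /eqP ur0.
have [ih eh] := fractional_solution_dot a G0 solx r0 (ltT _ rt).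
(* Multiplication by the sign turns the maximum of |u| at r into a maximum of [e * u]. *)
pose e := Num.sg (u r).
pose k z := (r - z) `^ (- alpha) * du z.
(* At z = s only a left neighbourhood is known to lie in the zero set, so there the value comes from
   the continuity of [du]. *)
have du0 z : 0 < z <= s -> du z = 0.
  have du0_lt y : 0 < y < s -> du y = 0.
    move=> ys; have yt : 0 < y <= t by lra.
    have /@derive_val <- := duP _ yt.
    rewrite -[RHS](derive_cst (0 : R) y 1); apply: near_eq_derive.
    have : y \in `]0, s[ by rewrite in_itv.
    move=> /near_in_itvoo; apply: filterS => w; rewrite in_itv/= => ws.
    by apply: us; lra.
  move=> /andP[z0]; rewrite le_eqVlt => /predU1P[zs|zs]; last by rewrite du0_lt// z0.
  have zt : 0 < z <= t by lra.
  transitivity (lim (du y @[y --> z^'-])).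
    by apply/esym/cvg_lim => //; apply: cvg_at_left_filter; exact: cdu.
  apply/cvg_lim => //; have : (0 : R) @[y --> z^'-] --> (0 : R^o) by exact: cvg_cst.
  apply: cvg_trans; apply: near_eq_cvg; near=> y.
  rewrite du0_lt//; apply/andP; split.
    by near: y; exact: nbhs_left_gt.
  by rewrite -zs; near: y; exact: nbhs_left_lt.
have ihs : mu.-integrable `]s, r[ (EFin \o k).
  apply: integrableS ih => //.
  by apply: subset_itvr; rewrite bnd_simp.
have split : \int[mu]_(z in `]0, r[) k z = \int[mu]_(z in `]s, r[) k z.
  rewrite Rintegral_mkcond [RHS]Rintegral_mkcond; congr (Rintegral _ _ _).
  apply/funext => z; rewrite !patchE !mem_setE !in_itv/=.
  have [sz|zs] := ltP s z; first by rewrite (le_lt_trans s0 sz).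
  case: ifP => // /andP[z0 _].
  by rewrite /k du0 ?mulr0// z0.
have eur : e * u r = `|u r| by rewrite /e -normrEsg.
have ur : 0 < `|u r| by rewrite normr_gt0.
have MP : (r - s) `^ (- alpha) * (e * u r - e * u s) <=
    \int[mu]_(z in `]s, r[) ((r - z) `^ (- alpha) * (e * du z)).
  apply: (@weighted_derive_ge_increment R alpha (fun z => e * u z) (fun z => e * du z)) => //.
  - have cu : {within `[s, r], continuous u}.
      apply: within_continuous_dot; apply: continuous_subspaceW cx => z /=.
      by rewrite !in_itv/=; exact: sub.
    by move=> z; apply: (@continuousM _ _ (cst e)); [exact: cst_continuous|exact: cu].
  - move=> z zsr; have zt := sub' _ zsr.
    exact: is_deriveZ (duP _ zt).
  - move=> z zsr; have zt := sub'' _ zsr.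
    by apply: cvgM; [exact: cvg_cst|exact: cdu].
  - have : mu.-integrable `]s, r[ (EFin \o (fun z => e * k z)).
      exact: integrable_EFinZl.
    by apply: eq_integrable => // z _ /=; rewrite /k mulrCA.
  - move=> z zsr; rewrite eur; apply: le_trans (umax _ zsr).
    rewrite (le_trans (ler_norm _))// normrM normr_sg ur0 mul1r//.
have Ie : \int[mu]_(z in `]s, r[) ((r - z) `^ (- alpha) * (e * du z)) =
    e * (G * dot a (f (x r))).
  rewrite -eh split -RintegralZl//.
  by apply: eq_Rintegral => z _; rewrite /k mulrCA.
rewrite Ie eur (us s) ?s0 ?lexx// mulr0 subr0 in MP.
have eG : e * (G * dot a (f (x r))) <= G * L * `|u r|.
  rewrite (le_trans (ler_norm _))// !normrM normr_sg ur0 mul1r (gtr0_norm G0).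
  by rewrite -mulrA ler_pM2l// tanL// xM.
have : d `^ (- alpha) <= (r - s) `^ (- alpha).
  rewrite !powRN lef_pV2 ?posrE ?powR_gt0 ?subr_gt0//.
  apply: (ge0_ler_powR (ltW a0)) => //; rewrite nnegrE; first by rewrite subr_ge0 ltW.
  exact: ltW.
rewrite dE => Kd.
have := le_trans (ler_wpM2r (ltW ur) Kd) (le_trans MP eG).
by rewrite ler_pM2r// gerDl leNgt ltr01.
Unshelve. all: by end_near. Qed.
End invariance.

(** * Weakly singular kernels *)

Section kernels.
Context {R : realType}.
Notation mu := (@lebesgue_measure R).

(** Monotone convergence along closed-in subintervals: on each of them the integral is an increment
    of [F], hence at most [M]. No limit of [F] at the ends has to be known beforehand. *)
Lemma ge0_integrable_of_primitive (h F : R -> R) (s t M : R) : s < t ->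
  (forall x, s < x < t -> 0 <= h x) ->
  (forall x, s < x < t -> {for x, continuous h}) ->
  (forall x, s < x < t -> is_derive x 1 F (h x)) ->
  (forall a b, s < a -> a < b -> b < t -> F b - F a <= M) ->
  mu.-integrable `]s, t[ (EFin \o h).
Proof.
move=> st h0 ch dF FM.
have mh : measurable_fun `]s, t[ h.
  apply: open_continuous_measurable_fun; first exact: interval_open.
  by move=> x; rewrite inE/= in_itv/=; exact: ch.
(* The denominator n + 3 keeps s + e n < t - e n already for n = 0. *)
pose e n : R := (t - s) / n.+3%:R.
have e0 n : 0 < e n by rewrite divr_gt0 ?subr_gt0.
have e3 n : e n * 3 <= t - s.
  by rewrite /e mulrAC ler_pdivrMr// ler_wpM2l ?subr_ge0 ?(ltW st)// ler_nat.
pose D n : set R := `]s + e n, t - e n[%classic.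
have DU : \bigcup_n D n = `]s, t[%classic.
  apply/seteqP; split => [x [n _]|x] /=; rewrite /D /= !in_itv/=.
    by have := e0 n; lra.
  move=> /andP[sx xt].
  pose m := Num.min (x - s) (t - x).
  have m0 : 0 < m by rewrite lt_min !subr_gt0 sx.
  exists (Num.bound ((t - s) / m)) => //=; rewrite in_itv/=.
  suff : e (Num.bound ((t - s) / m)) < m by rewrite /m lt_min; lra.
  rewrite /e ltr_pdivrMr// mulrC -ltr_pdivrMr//.
  apply: lt_le_trans (archi_boundP _) _; first by rewrite divr_ge0 ?subr_ge0 ?ltW.
  by rewrite ler_nat; do 3 apply: leqW.
have subD n : D n `<=` `]s, t[ by rewrite -DU; exact: bigcup_sup.
apply/integrableP; split; first exact/measurable_EFinP.
rewrite (_ : (\int[mu]_(x in `]s, t[) _)%E = (\int[mu]_(x in `]s, t[) (h x)%:E)%E); last first.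
  apply: eq_integral => x; rewrite inE/= in_itv/= => xst.
  by rewrite ger0_norm// h0.
rewrite (@le_lt_trans _ _ M%:E) ?ltry// -DU.
have ndD : {homo D : n m / (n <= m)%N >-> (n <= m)%O}.
  move=> n m nm; apply/subsetPset => x; rewrite /D /= !in_itv/=.
  suff : e m <= e n by lra.
  by rewrite /e ler_pM2l ?subr_gt0// lef_pV2 ?posrE// ler_nat.
have cvD : (\int[mu]_(x in D n) (h x)%:E)%E @[n --> \oo] -->
    (\int[mu]_(x in \bigcup_n D n) (h x)%:E)%E.
  apply: ge0_nondecreasing_set_cvg_integral => //.
  - by move=> n; exact: measurable_itv.
  - by move=> n; apply/(@measurable_EFinP _ _ _ (D n) h); exact: measurable_funS mh.
  - by move=> n x /subD/=; rewrite in_itv/= lee_fin; exact: h0.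
apply: (cvge_to_le cvD).
apply: nearW => n /=.
have sn := e0 n; have sn3 := e3 n.
have abn : s + e n < t - e n by lra.
have ih : mu.-integrable (D n) (EFin \o h).
  have : mu.-integrable `[s + e n, t - e n] (EFin \o h).
    apply: continuous_compact_integrable; first exact: segment_compact.
    apply: continuous_in_subspaceT => x; rewrite inE/= in_itv/= => xab.
    by apply: ch; lra.
  by apply: integrableS => //; [exact: measurable_itv|move=> x; exact: subset_itv_oo_cc].
have cF x : s < x < t -> {for x, continuous F}.
  by move=> /dF[/derivable1_diffP/differentiable_continuous].
have fin : (\int[mu]_(x in D n) (h x)%:E)%E \is a fin_num.
  by apply: integrable_fin_num => //; exact: measurable_itv.
rewrite -(fineK fin).
rewrite -/(Rintegral mu (D n) h) lee_fin.
suff -> : \int[mu]_(x in D n) h x = F (t - e n) - F (s + e n) by apply: FM; lra.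
apply: open_FTC => //.
- by move=> x xab; apply: ch; lra.
- by move=> x xab; apply: dF; lra.
- by apply: cvg_at_right_filter; apply: cF; lra.
- by apply: cvg_at_left_filter; apply: cF; lra.
Qed.

Lemma integrable_powR_oo (p t : R) : -1 < p -> 0 < t ->
  mu.-integrable `]0, t[ (EFin \o (fun x => x `^ p)).
Proof.
move=> p1 t0; have q0 : 0 < p + 1 by lra.
have dp (x q : R) : 0 < x -> is_derive x 1 (fun x => x `^ q) (q * x `^ (q - 1)).
  by move=> x0; exact: is_derive1_powR.
apply: (@ge0_integrable_of_primitive _ (fun x => (p + 1)^-1 * x `^ (p + 1)) 0 t
  ((p + 1)^-1 * t `^ (p + 1))) => //.
- by move=> x _; exact: powR_ge0.
- move=> x /andP[x0 _].
  by have [/derivable1_diffP/differentiable_continuous + _] := dp x p x0.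
- move=> x /andP[x0 _].
  apply: is_derive_eq (is_deriveZ (p + 1)^-1 (dp x (p + 1) x0)) _.
  by rewrite /GRing.scale/= mulrA mulVf ?gt_eqF// mul1r addrK.
move=> a b a0 ab bt; rewrite -mulrBr ler_pM2l ?invr_gt0//.
rewrite (@le_trans _ _ (b `^ (p + 1)))//; first by rewrite gerBl powR_ge0.
by apply: ge0_ler_powR; rewrite ?nnegrE; lra.
Qed.

Lemma Rintegral_powR_oo (p t : R) : -1 < p -> 0 <= t ->
  \int[mu]_(x in `]0, t[) (x `^ p) = t `^ (p + 1) / (p + 1).
Proof.
move=> p1; have q0 : 0 < p + 1 by lra.
rewrite le_eqVlt => /predU1P[<-|t0].
  by rewrite set_itv_ge ?bnd_simp ?ltxx// Rintegral_set0 powR0 ?mul0r// gt_eqF.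
have dp (x q : R) : 0 < x -> is_derive x 1 (fun x => x `^ q) (q * x `^ (q - 1)).
  by move=> x0; exact: is_derive1_powR.
rewrite mulrC -[RHS]subr0 -[X in _ - X](mulr0 (p + 1)^-1).
apply: (@open_FTC R (fun x => x `^ p) (fun x => (p + 1)^-1 * x `^ (p + 1))) => //.
- exact: integrable_powR_oo.
- move=> x /andP[x0 _].
  by have [/derivable1_diffP/differentiable_continuous + _] := dp x p x0.
- move=> x /andP[x0 _].
  apply: is_derive_eq (is_deriveZ (p + 1)^-1 (dp x (p + 1) x0)) _.
  by rewrite /GRing.scale/= mulrA mulVf ?gt_eqF// mul1r addrK.
- by apply: cvgM; [exact: cvg_cst|exact: powR_cvg0].
- apply: cvgM; first exact: cvg_cst.
  apply: cvg_at_left_filter.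
  by have [/derivable1_diffP/differentiable_continuous + _] := dp t (p + 1) t0.
Qed.

Lemma Rintegral_gt0 (D : set R) (h : R -> R) (u v c : R) :
  measurable D -> u < v -> 0 < c -> `]u, v[ `<=` D ->
  mu.-integrable D (EFin \o h) ->
  (forall x, D x -> 0 <= h x) -> (forall x, u < x < v -> c <= h x) ->
  0 < \int[mu]_(x in D) h x.
Proof.
move=> mD uv c0 subD ih h0 ch.
have fih : (\int[mu]_(x in D) (h x)%:E)%E \is a fin_num by exact: integrable_fin_num.
rewrite -lte_fin fineK//.
have : (c%:E * mu `]u, v[ <= \int[mu]_(x in `]u, v[) (h x)%:E)%E.
  rewrite -integral_cst//; apply: ge0_le_integral => //.
  - by move=> x _; rewrite lee_fin ltW.
  - by case/integrableP : ih => mh _; exact: measurable_funS mh.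
rewrite lebesgue_measure_itv/= lte_fin uv -EFinD -EFinM => cuv.
apply: lt_le_trans (_ : ((c * (v - u))%:E <= _)%E).
  by rewrite lte_fin mulr_gt0// subr_gt0.
apply: (le_trans cuv); apply: ge0_subset_integral => //.
by case/integrableP : ih.
Qed.
End kernels.

(** * Affine change of variables in Lebesgue integrals *)

Section affine.
Context {R : realType}.
Notation mu := (@lebesgue_measure R).

Lemma measurable_affine (s k : R) : measurable_fun setT (fun r => s + k * r).
Proof. by apply: measurable_funD => //; apply: measurable_funM. Qed.

(** The right-hand side is a measure with the same values as Lebesgue measure on half-open
    intervals, and these values determine it. *)
Lemma lebesgue_measure_affine (s k : R) (k0 : 0 < k) (A : set (measurableTypeR R)) :
  measurable A ->
  mu A = (k%:E * pushforward mu (fun r => s + k * r : measurableTypeR R)%R A)%E.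
Proof.
move=> mA.
have mphi : @measurable_fun _ _ (measurableTypeR R) (measurableTypeR R) setT (fun r => s + k * r).
  exact: measurable_affine.
pose phi : {mfun measurableTypeR R >-> measurableTypeR R} :=
  @mfun_Sub _ _ (measurableTypeR R) (measurableTypeR R) _ (mem_set mphi).
have := @lebesgue_measure_unique R (mscale (NngNum (ltW k0)) (pushforward mu phi)).
apply => //.
move=> _ [[a b]] _ <-.
have pre : phi @^-1` `]a, b] = `](a - s) / k, (b - s) / k]%classic.
  by apply/seteqP; split => r /=; rewrite !in_itv/= ltr_pdivrMr// ler_pdivlMr//; lra.
transitivity (k%:E * mu (phi @^-1` `]a, b]))%E; last by [].
rewrite pre.
rewrite !lebesgue_measure_itv/= !lte_fin ltr_pM2r ?invr_gt0// ltrD2r.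
case: ifP => _; last by rewrite mule0.
by rewrite -!EFinD -EFinM; congr (_%:E); field; rewrite gt_eqF.
Qed.

Lemma ge0_integral_affine (s t : R) (f : R -> \bar R) : s < t ->
  measurable_fun setT f -> (forall x, 0 <= f x)%E ->
  (\int[mu]_(x in `]s, t[) f x =
   (t - s)%:E * \int[mu]_(r in `]0%R, 1%R[) f (s + (t - s) * r)%R)%E.
Proof.
move=> st + f0 => mf; have {}mf : @measurable_fun _ _ (measurableTypeR R) _ setT f := mf.
have k0 : 0 < t - s by rewrite subr_gt0.
pose phi (r : measurableTypeR R) : measurableTypeR R := s + (t - s) * r.
have mphi : @measurable_fun _ _ (measurableTypeR R) (measurableTypeR R) setT phi.
  exact: measurable_affine.
have phiE : phi @^-1` `]s, t[ = `]0, 1[%classic.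
  by apply/seteqP; split => r /=; rewrite /phi !in_itv/=; nra.
pose nu_ : {measure set (measurableTypeR R) -> \bar R} := pushforward mu phi.
pose nu := nu_ mphi.
pose nu' : {measure set (measurableTypeR R) -> \bar R} := mscale (NngNum (ltW k0)) nu.
have mst : @measurable _ (measurableTypeR R) `]s, t[ by exact: measurable_itv.
transitivity (\int[nu']_(x in `]s, t[) f x)%E.
  by apply: eq_measure_integral => A mA _; exact: lebesgue_measure_affine.
have mfst : @measurable_fun _ _ (measurableTypeR R) _ `]s, t[ f by exact: measurable_funS mf.
transitivity ((t - s)%:E * \int[nu]_(x in `]s, t[) f x)%E.
  by apply: ge0_integral_mscale.
congr (_ * _)%E.
transitivity (\int[mu]_(x in phi @^-1` `]s, t[) (f \o phi) x)%E.
  by apply: ge0_integral_pushforward.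
by rewrite phiE.
Qed.
End affine.

(** * Beta kernels and the positivity of Gamma *)

Section kernel.
Context {R : realType}.
Notation mu := (@lebesgue_measure R).

(** The nonnegative case is applied to |f| for the integrability and to the positive and negative
    parts of f for the value. *)
Lemma Rintegral_affine (s t : R) (f : R -> R) : s < t ->
  measurable_fun setT f -> mu.-integrable `]s, t[ (EFin \o f) ->
  mu.-integrable `]0, 1[ (EFin \o (fun r => f (s + (t - s) * r))) /\
  \int[mu]_(x in `]s, t[) f x =
    (t - s) * \int[mu]_(r in `]0, 1[) f (s + (t - s) * r).
Proof.
move=> st mf intf; have k0 : 0 < t - s by rewrite subr_gt0.
have mEf : measurable_fun setT (EFin \o f) by exact/measurable_EFinP.
have mfphi : measurable_fun setT (fun r => f (s + (t - s) * r)).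
  by apply: measurableT_comp => //; exact: measurable_affine.
have intg : mu.-integrable `]0, 1[ (EFin \o (fun r => f (s + (t - s) * r))).
  apply/integrableP; split; first by apply/measurable_EFinP; exact: measurable_funTS.
  have : (\int[mu]_(x in `]s, t[) `|(EFin \o f) x| < +oo)%E by case/integrableP : intf.
  rewrite (ge0_integral_affine st (f := abse \o (EFin \o f))); last 2 first.
  - exact: measurableT_comp.
  - by move=> x; exact: abse_ge0.
  rewrite -(@lte_pdivlMl _ (t - s))// [X in (_ < X)%E]gt0_muley//.
  by rewrite lte_fin invr_gt0.
split=> //; rewrite /Rintegral.
suff -> : (\int[mu]_(x in `]s, t[) (f x)%:E =
    (t - s)%:E * \int[mu]_(r in `]0%R, 1%R[) (f (s + (t - s) * r)%R)%:E)%E.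
  rewrite fineM//; apply: integrable_fin_num intg => //.
rewrite integralE [X in (_ = _ * X)%E]integralE muleBr//; last first.
  apply: fin_num_adde_defr.
  have : (\int[mu]_(r in `]0%R, 1%R[) ((EFin \o (fun r => f (s + (t - s) * r)%R)) ^\+ r) \is a fin_num)%E.
    exact: integrable_pos_fin_num.
  by [].
have Epos := @ge0_integral_affine R s t ((EFin \o f)^\+%E) st
  (measurable_funepos mEf) (funepos_ge0 _).
have Eneg := @ge0_integral_affine R s t ((EFin \o f)^\-%E) st
  (measurable_funeneg mEf) (funeneg_ge0 _).
congr (_ - _)%E.
  by rewrite [LHS]Epos; congr (_ * _)%E; apply: eq_integral => x _; rewrite !funeposE.
by rewrite [LHS]Eneg; congr (_ * _)%E; apply: eq_integral => x _; rewrite !funenegE.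
Qed.

Definition beta_kernel (p q s t x : R) : R := (t - x) `^ p * (x - s) `^ q.

(** Euler's B(p + 1, q + 1): the arguments are the exponents themselves. *)
Definition Beta (p q : R) : R := \int[mu]_(x in `]0, 1[) beta_kernel p q 0 1 x.

Lemma beta_kernel_ge0 p q s t x : 0 <= beta_kernel p q s t x.
Proof. by rewrite mulr_ge0// powR_ge0. Qed.

Lemma measurable_beta_kernel p q s t : measurable_fun setT (beta_kernel p q s t).
Proof.
apply: measurable_funM.
  by apply: (measurableT_comp (measurable_powR p)); exact: measurable_funB.
by apply: (measurableT_comp (measurable_powR q)); exact: measurable_funB.
Qed.

Lemma powR_le2 (p x : R) : -1 <= p -> 2^-1 <= x -> x <= 1 -> x `^ p <= 2.
Proof.
move=> p1 x2 x1; have x0 : 0 < x by lra.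
rewrite (@le_trans _ _ (x `^ (- 1)))//; first by apply: ger_powR => //; rewrite x0.
by rewrite powR_inv1 ?(ltW x0)// -[leRHS]invrK lef_pV2// posrE invr_gt0.
Qed.

Lemma integrable_powR_onem_oo (p : R) : -1 < p ->
  mu.-integrable `]0, 1[ (EFin \o (fun x => (1 - x) `^ p)).
Proof.
move=> p1; have q0 : 0 < p + 1 by lra.
have dp (x q : R) : x < 1 ->
    is_derive x 1 (fun x => (1 - x) `^ q) (- (q * (1 - x) `^ (q - 1))).
  move=> x1; have x1' : 0 < 1 - x by rewrite subr_gt0.
  have := @is_derive1_comp R (fun y => y `^ q) (fun x => 1 - x) x _ _
    (is_derive1_powR q x1') (is_deriveB (is_derive_cst (1 : R) x 1) (is_derive_id x 1)).
  by move=> h; apply: is_derive_eq h _; ring.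
apply: (@ge0_integrable_of_primitive _ _ (fun x => - (p + 1)^-1 * (1 - x) `^ (p + 1))
  0 1 ((p + 1)^-1)) => //.
- by move=> x _; exact: powR_ge0.
- move=> x /andP[_ x1].
  by have [/derivable1_diffP/differentiable_continuous + _] := dp x p x1.
- move=> x /andP[_ x1].
  apply: is_derive_eq (is_deriveZ (- (p + 1)^-1) (dp x (p + 1) x1)) _.
  by rewrite /GRing.scale/= mulrNN mulrA mulVf ?gt_eqF// mul1r addrK.
move=> a b a0 ab b1; rewrite !mulNr opprK addrC -mulrBr.
rewrite ler_piMr ?invr_ge0 ?(ltW q0)//.
have : (1 - a) `^ (p + 1) <= 1.
  rewrite [leRHS](_ : 1 = 1 `^ (p + 1)); last by rewrite powR1.
  by apply: ge0_ler_powR; rewrite ?nnegrE; lra.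
by have := powR_ge0 (1 - b) (p + 1); lra.
Qed.

(** On each half of ]0, 1[ only one factor is singular and the other is at most 2, so the kernel is
    dominated by 2 ((1 - x)^p + x^q). *)
Lemma integrable_beta_kernel01 p q : -1 < p <= 0 -> -1 < q <= 0 ->
  mu.-integrable `]0, 1[ (EFin \o beta_kernel p q 0 1).
Proof.
move=> /andP[p1 p0] /andP[q1 q0].
have ip := integrable_powR_onem_oo p1.
have iq := integrable_powR_oo q1 ltr01.
have : mu.-integrable `]0, 1[ (EFin \o (fun x => 2 * ((1 - x) `^ p + x `^ q))).
  apply: integrable_EFinZl => //.
  have : mu.-integrable `]0, 1[ ((EFin \o (fun x => (1 - x) `^ p)) \+ (EFin \o (fun x => x `^ q))).
    exact: integrableD.
  by apply: eq_integrable.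
apply: le_integrable => //.
  by apply/measurable_EFinP; apply: measurable_funTS; exact: measurable_beta_kernel.
move=> x /=; rewrite in_itv/= => /andP[x0 x1]; rewrite lee_fin.
rewrite ger0_norm ?beta_kernel_ge0// ger0_norm; last first.
  by rewrite mulr_ge0// addr_ge0// powR_ge0.
rewrite /beta_kernel subr0.
have P := powR_ge0 (1 - x) p; have Q := powR_ge0 x q.
have [x2|x2] := leP 2^-1 x.
  have := @powR_le2 q x (ltW q1) x2 (ltW x1); nra.
have : (1 - x) `^ p <= 2 by apply: powR_le2; lra.
nra.
Qed.

Lemma Beta_gt0 p q : -1 < p <= 0 -> -1 < q <= 0 -> 0 < Beta p q.
Proof.
move=> pp qq; apply: (@Rintegral_gt0 R _ _ 0 1 1) => //.
- exact: integrable_beta_kernel01.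
- by move=> x _; exact: beta_kernel_ge0.
move=> x /andP[x0 x1]; rewrite -[leLHS]mulr1 /beta_kernel ler_pM//.
  by rewrite -[leLHS](powRr0 (1 - x)); apply: ger_powR; lra.
by rewrite subr0 -[leLHS](powRr0 x); apply: ger_powR; lra.
Qed.

Lemma beta_kernel_affine p q s t r : s < t -> 0 < r < 1 ->
  beta_kernel p q s t (s + (t - s) * r) =
  (t - s) `^ (p + q) * beta_kernel p q 0 1 r.
Proof.
move=> st /andP[r0 r1]; rewrite /beta_kernel.
rewrite (_ : t - _ = (t - s) * (1 - r)); last by ring.
rewrite (_ : s + _ - s = (t - s) * r); last by ring.
have k0 : 0 < t - s by lra.
rewrite !powRM; try lra.
rewrite powRD ?(gt_eqF k0) ?implybT//.
by rewrite subr0; ring.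
Qed.

(** Stated for the extended real integral, so that the finite value also yields integrability of
    this nonnegative kernel. *)
Lemma integral_beta_kernel p q s t : -1 < p <= 0 -> -1 < q <= 0 -> s < t ->
  (\int[mu]_(x in `]s, t[) (beta_kernel p q s t x)%:E =
    ((t - s) `^ (p + q + 1) * Beta p q)%:E)%E.
Proof.
move=> pp qq st; have k0 : 0 < t - s by lra.
have i01 := integrable_beta_kernel01 pp qq.
rewrite (ge0_integral_affine st (f := fun x => (beta_kernel p q s t x)%:E)); last 2 first.
  by apply/measurable_EFinP; exact: measurable_beta_kernel.
  by move=> x; rewrite lee_fin beta_kernel_ge0.
transitivity ((t - s)%:E *
    \int[mu]_(r in `]0%R, 1%R[) (((t - s) `^ (p + q))%:E * (beta_kernel p q 0 1 r)%:E))%E.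
  congr (_ * _)%E; apply: eq_integral => r; rewrite inE/= in_itv/= => r01.
  by rewrite beta_kernel_affine// EFinM.
rewrite integralZl// muleA -EFinM /Beta /Rintegral [in RHS]EFinM fineK; last first.
  by apply: integrable_fin_num i01.
congr (_%:E * _)%E.
rewrite (@powRD _ (t - s) (p + q) 1) ?(gt_eqF k0) ?implybT//.
by rewrite powRr1 ?ltW// mulrC.
Qed.

Lemma integrable_beta_kernel p q s t : -1 < p <= 0 -> -1 < q <= 0 -> s < t ->
  mu.-integrable `]s, t[ (EFin \o beta_kernel p q s t).
Proof.
move=> pp qq st; apply/integrableP; split.
  by apply/measurable_EFinP; apply: measurable_funTS; exact: measurable_beta_kernel.
under eq_integral do rewrite /= ger0_norm ?beta_kernel_ge0//.
by rewrite integral_beta_kernel// ltry.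
Qed.

Lemma integrableM_bounded d (T : measurableType d) (nu : {measure set T -> \bar R})
    (D : set T) (g h : T -> R) (M : R) :
  measurable D -> measurable_fun D h -> (forall x, D x -> `|h x| <= M) ->
  nu.-integrable D (EFin \o g) -> nu.-integrable D (EFin \o (fun x => g x * h x)).
Proof.
move=> mD mh hM ig.
have : nu.-integrable D (EFin \o (fun x => M * g x)) by exact: integrable_EFinZl.
apply: le_integrable => //.
  by apply/measurable_EFinP; apply: measurable_funM => //; apply/measurable_EFinP; case/integrableP : ig.
move=> x Dx /=; rewrite lee_fin !normrM mulrC ler_wpM2r//.
by rewrite (le_trans (hM _ Dx))// ler_norm.
Qed.

(** The integrand is dominated by t^(z-1) on ]0, 1[ plus the exponential density, hence integrable,
    and it is at least exp(-1) on ]0, 1[. *)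
Lemma Gamma_gt0 (z : R) : 0 < z <= 1 -> 0 < Gamma z.
Proof.
move=> /andP[z0 z1].
have mg : measurable_fun setT (fun t : R => t `^ (z - 1) * expR (- t)).
  apply: measurable_funM; first exact: measurable_powR.
  by apply: measurableT_comp => //; exact: measurableT_comp.
have ie : mu.-integrable setT (EFin \o exponential_pdf 1).
  apply/integrableP; split; first by apply/measurable_EFinP; exact: measurable_exponential_pdf.
  under eq_integral do rewrite /= ger0_norm ?exponential_pdf_ge0//.
  by rewrite integral_exponential_pdf// ltry.
have ip : mu.-integrable setT ((EFin \o (fun t => t `^ (z - 1))) \_ `]0, 1[).
  apply: (iffLR (integrable_mkcond _ _)); first exact: measurable_itv.
  by apply: integrable_powR_oo => //; lra.
have ig : mu.-integrable `]0, +oo[ (EFin \o (fun t => t `^ (z - 1) * expR (- t))).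
  have : mu.-integrable `]0, +oo[
      (((EFin \o (fun t => t `^ (z - 1))) \_ `]0, 1[) \+ (EFin \o exponential_pdf 1)).
    by apply: (@integrableS _ _ _ mu setT) => //; exact: integrableD.
  apply: le_integrable => //.
    by apply/measurable_EFinP; exact: measurable_funTS.
  move=> x /=; rewrite in_itv/= andbT => x0.
  have P := powR_ge0 x (z - 1); have E0 := expR_ge0 (- x).
  have -> : ((EFin \o (fun t => t `^ (z - 1))) \_ `]0, 1[) x =
      (if x < 1 then x `^ (z - 1) else 0)%:E.
    by rewrite patchE mem_setE in_itv/= x0; case: (x < 1).
  have -> : exponential_pdf 1 x = expR (- x).
    by rewrite /exponential_pdf patchE mem_setE in_itv/= (ltW x0)/= mulN1r mul1r.
  rewrite -EFinD !abse_EFin lee_fin [leLHS]ger0_norm ?mulr_ge0//.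
  apply: le_trans (ler_norm _); have [x1|x1] := ltP x 1.
    rewrite (@le_trans _ _ (x `^ (z - 1)))//; last by rewrite lerDl.
    by rewrite ler_piMr// -[leRHS]expR0 ler_expR; lra.
  rewrite add0r ler_piMl//.
  rewrite [leRHS](_ : 1 = x `^ 0); last by rewrite powRr0.
  by apply: ler_powR => //; lra.
apply: (@Rintegral_gt0 R _ _ 0 1 (expR (- 1)) _ ltr01 (expR_gt0 _) _ ig) => //.
- by move=> x /=; rewrite !in_itv/= andbT => /andP[].
- by move=> x _; rewrite mulr_ge0 ?powR_ge0// expR_ge0.
move=> x /andP[x0 x1]; rewrite -[leLHS]mul1r ler_pM// ?expR_ge0//; last first.
  by rewrite ler_expR; lra.
rewrite [leLHS](_ : 1 = x `^ 0); last by rewrite powRr0.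
by apply: ger_powR; lra.
Qed.
End kernel.

(** * Abel inversion *)

Section abel.
Context {R : realType}.
Notation mu := (@lebesgue_measure R).
Notation M := (measurableTypeR R).

Lemma Rintegral_beta_kernel_scale p q (h : R -> R) (H t : R) :
  -1 < p <= 0 -> -1 < q <= 0 -> 0 < t ->
  measurable_fun setT h -> (forall x, `|h x| <= H) ->
  \int[mu]_(s in `]0, t[) (beta_kernel p q 0 t s * h s) =
  t `^ (p + q + 1) * \int[mu]_(r in `]0, 1[) (beta_kernel p q 0 1 r * h (t * r)).
Proof.
move=> pp qq t0 mh hH.
have i1 : mu.-integrable `]0, t[ (EFin \o (fun s => beta_kernel p q 0 t s * h s)).
  apply: (integrableM_bounded (M := H)) => //; first exact: measurable_funTS.
  exact: integrable_beta_kernel.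
have m1 : measurable_fun setT (fun s => beta_kernel p q 0 t s * h s).
  by apply: measurable_funM => //; exact: measurable_beta_kernel.
have [_ ->] := Rintegral_affine t0 m1 i1; rewrite subr0.
have mht : measurable_fun setT (fun r : R => h (t * r)).
  by apply: measurableT_comp => //; exact: measurable_funM.
have i2 : mu.-integrable `]0, 1[ (EFin \o (fun r => beta_kernel p q 0 1 r * h (t * r))).
  apply: (integrableM_bounded (M := H)) => //; last exact: integrable_beta_kernel01.
  exact: measurable_funTS.
rewrite (_ : t `^ (p + q + 1) = t * t `^ (p + q)); last first.
  by rewrite (@powRD _ t (p + q) 1) ?(gt_eqF t0) ?implybT// powRr1 ?(ltW t0)// mulrC.
rewrite -mulrA; congr (_ * _); rewrite -RintegralZl//.
apply: eq_Rintegral => r; rewrite inE/= in_itv/= => r01.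
have := beta_kernel_affine p q t0 r01; rewrite subr0 add0r => ->.
by rewrite mulrA.
Qed.

(** Fubini on the triangle 0 < s < x < t. For fixed s the integral of (t - x)^p (x - s)^q over x in
    ]s, t[ is (t - s)^(p+q+1) Beta p q, and p + q + 1 = 0 removes the dependence on s. *)
Lemma Rintegral_triangle (p q t H : R) (h : R -> R) :
  -1 < p <= 0 -> -1 < q <= 0 -> p + q + 1 = 0 -> 0 < t ->
  measurable_fun setT h -> (forall x, `|h x| <= H) ->
  \int[mu]_(x in `]0, t[) ((t - x) `^ p *
     \int[mu]_(s in `]0, x[) (beta_kernel q q 0 x s * h s)) =
  Beta p q * \int[mu]_(s in `]0, t[) (s `^ q * h s).
Proof.
move=> pp qq pq t0 mh hH.
pose A : set (M * M) := [set x | [/\ 0 < x.2, x.2 < x.1 & x.1 < t]].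
pose F0 (x : M * M) : R := (t - x.1) `^ p * (x.1 - x.2) `^ q * (x.2 `^ q * h x.2).
pose F : M * M -> \bar R := (EFin \o F0) \_ A.
have m1 : measurable_fun setT (fst : M * M -> R) by exact: measurable_fst.
have m2 : measurable_fun setT (snd : M * M -> R) by exact: measurable_snd.
have mA : measurable A.
  rewrite (_ : A = (snd : M * M -> R) @^-1` `]0, +oo[ `&`
     ((fun x : M * M => x.1 - x.2) @^-1` `]0, +oo[ `&`
     (fst : M * M -> R) @^-1` `]-oo, t[)); last first.
    apply/seteqP; split => x; rewrite /A/= !in_itv/= !andbT subr_gt0.
      by case.
    by case=> ? [].
  apply: measurableI; [|apply: measurableI]; rewrite -[_ @^-1` _]setTI.
  - exact: m2.
  - by apply: measurable_funB.
  - exact: m1.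
have mF0 : measurable_fun setT F0.
  apply: measurable_funM; first apply: measurable_funM.
  - by apply: (measurableT_comp (measurable_powR p)); exact: measurable_funB.
  - by apply: (measurableT_comp (measurable_powR q)); exact: measurable_funB.
  apply: measurable_funM; last exact: measurableT_comp.
  exact: (measurableT_comp (measurable_powR q)).
have mF : measurable_fun setT F.
  have mEF0 : measurable_fun setT (EFin \o F0) by exact: measurableT_comp.
  apply: (iffLR (measurable_restrictT _ _)) => //; exact: measurable_funTS.
have FE x s : F (x, s) = (if [&& 0 < s, s < x & x < t] then F0 (x, s) else 0)%:E.
  rewrite /F patchE; case: ifPn => [|/negP]; rewrite inE /A/=.
    by case=> -> -> ->.
  by move=> nA; case: ifPn => // /and3P[s0 sx xt]; case: nA; split.
have Etau (c : R -> R) s : 0 < s -> (\int[mu]_x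
    (if [&& 0 < s, s < x & x < t] then beta_kernel p q s t x * c s else 0)%:E =
    \int[mu]_(x in `]s, t[) (beta_kernel p q s t x * c s)%:E)%E.
  move=> s0; rewrite [RHS]integral_mkcond; apply: eq_integral => x _.
  by rewrite patchE mem_setE in_itv/= s0/=; case: ifP.
have Kst s : 0 < s < t -> (\int[mu]_(x in `]s, t[) (beta_kernel p q s t x)%:E =
    (Beta p q)%:E)%E.
  by move=> /andP[_ st]; rewrite integral_beta_kernel// pq powRr0 mul1r.
(* Quantified over [c] because it is applied twice: to |c| for the integrability that Fubini asks
   for, and to [c] for the value. *)
have inner_tau (c : R -> R) s : (\int[mu]_x
    (if [&& 0 < s, s < x & x < t] then beta_kernel p q s t x * c s else 0)%:E =
    (if 0 < s < t then Beta p q * c s else 0)%:E)%E.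
  have [/andP[s0 st]|nst] := ifP.
    rewrite Etau//.
    have ik := integrable_beta_kernel pp qq st.
    transitivity (\int[mu]_(x in `]s, t[) ((c s)%:E * (beta_kernel p q s t x)%:E))%E.
      by apply: eq_integral => x _; rewrite -EFinM mulrC.
    by rewrite integralZl// Kst ?s0// -EFinM mulrC.
  rewrite integral0_eq// => x _; case: ifP => // /and3P[s0 sx xt].
  by move: nst; rewrite s0 (lt_trans sx xt).
pose c s := s `^ q * h s.
have FcE x s : F (x, s) = (if [&& 0 < s, s < x & x < t] then beta_kernel p q s t x * c s else 0)%:E.
  by rewrite FE.
have FaE x s : `|F (x, s)|%E = (if [&& 0 < s, s < x & x < t] then beta_kernel p q s t x * `|c s| else 0)%:E.
  rewrite FcE; case: ifP => _; last by rewrite /= normr0.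
  by rewrite abse_EFin normrM ger0_norm ?beta_kernel_ge0.
have ic : mu.-integrable `]0, t[ (EFin \o c).
  apply: (integrableM_bounded (M := H)) => //; first exact: measurable_funTS.
  by apply: integrable_powR_oo => //; case/andP : qq.
have ibc (k : R -> R) : mu.-integrable `]0, t[ (EFin \o k) ->
    (\int[mu]_s (if 0 < s < t then Beta p q * k s else 0)%:E =
     (Beta p q * \int[mu]_(s in `]0, t[) k s)%:E)%E.
  move=> ik; transitivity (\int[mu]_(s in `]0%R, t[) ((Beta p q)%:E * (k s)%:E))%E.
    rewrite [RHS]integral_mkcond; apply: eq_integral => s _.
    by rewrite patchE mem_setE in_itv/=; case: ifP.
  rewrite integralZl// EFinM; congr (_ * _)%E.
  by apply/esym/fineK; apply: integrable_fin_num => //; exact: ik.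
have iF : (mu \x mu)%E.-integrable setT F.
  apply/integrable21ltyP => //.
  rewrite (_ : (\int[mu]_s _)%E = (\int[mu]_s (if 0 < s < t then Beta p q * `|c s| else 0)%:E)%E).
    by rewrite (ibc (fun s => `|c s|)) ?ltry//; exact: integrable_norm.
  apply: eq_integral => s _; rewrite -(inner_tau (fun s => `|c s|)).
  by apply: eq_integral => x _; rewrite FaE.
have := Fubini iF.
have -> : (\int[mu]_s \int[mu]_x F (x, s) =
    (Beta p q * \int[mu]_(s in `]0, t[) c s)%:E)%E.
  rewrite -ibc//; apply: eq_integral => s _; rewrite -inner_tau.
  by apply: eq_integral => x _; rewrite FcE.
pose G x := (t - x) `^ p * \int[mu]_(s in `]0, x[) (beta_kernel q q 0 x s * h s).
have -> : (\int[mu]_x \int[mu]_s F (x, s) = \int[mu]_(x in `]0%R, t[) (G x)%:E)%E.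
  rewrite [RHS]integral_mkcond; apply: eq_integral => x _.
  rewrite patchE mem_setE in_itv/=; case: ifPn => [/andP[x0 xt]|nx]; last first.
    rewrite integral0_eq// => s _; rewrite FcE; case: ifP => // /and3P[s0 sx xt].
    by move: nx; rewrite xt (lt_trans s0 sx).
  have ik : mu.-integrable `]0, x[ (EFin \o (fun s => beta_kernel q q 0 x s * h s)).
    apply: (integrableM_bounded (M := H)) => //; first exact: measurable_funTS.
    exact: integrable_beta_kernel.
  rewrite /G EFinM (_ : (Rintegral _ _ _)%:E =
      \int[mu]_(s in `]0%R, x[) (beta_kernel q q 0 x s * h s)%:E)%E; last first.
    by apply: fineK; apply: integrable_fin_num => //; exact: ik.
  rewrite -integralZl// [RHS]integral_mkcond; apply: eq_integral => s _.
  rewrite patchE mem_setE in_itv/= FcE xt andbT; case: ifP => // _.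
  by rewrite -EFinM /beta_kernel /c subr0; congr (_%:E); ring.
by move=> /(congr1 fine).
Qed.

(** In the scaled form the interval and the singular weight are fixed and the parameter sits inside
    h alone. Domination by H |w| then gives continuity everywhere, including at 0. *)
Lemma continuous_dilation_integral (w h : R -> R) (H : R) :
  mu.-integrable `]0, 1[ (EFin \o w) -> continuous h -> (forall x, `|h x| <= H) ->
  continuous (fun x : R => \int[mu]_(r in `]0, 1[) (w r * h (x * r))).
Proof.
move=> iw ch hH x0.
have mh : measurable_fun setT h by exact: continuous_measurable_fun.
have mhx x : measurable_fun setT (fun r : R => h (x * r)).
  by apply: measurableT_comp => //; exact: measurable_funM.
have iwh x : mu.-integrable `]0, 1[ (EFin \o (fun r => w r * h (x * r))).
  by apply: (integrableM_bounded (M := H)) => //; exact: (measurable_funTS (mhx x)).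
have iHw : mu.-integrable `]0, 1[ (EFin \o (fun r => H * `|w r|)).
  by apply: integrable_EFinZl => //; exact: integrable_norm.
apply: (@continuity_under_integral R _ _ mu (fun x r => w r * h (x * r)) _ _
  (x0 - 1) (x0 + 1) _ _ (fun r => H * `|w r|)) => //.
- apply: aeW => r _ x _.
  apply: (@continuousM _ _ (cst (w r))); first exact: cst_continuous.
  apply: continuous_comp; last exact: ch.
  by apply: (@continuousM _ _ id (cst r)); [exact: cvg_id|exact: cst_continuous].
- move=> x _; apply: aeW => r _.
  by rewrite normrM mulrC ler_wpM2r.
- by rewrite inE/= in_itv/=; lra.
Qed.

Lemma dilation_integral_le (w h : R -> R) (H : R) :
  mu.-integrable `]0, 1[ (EFin \o w) -> (forall r, 0 <= w r) ->
  measurable_fun setT h ->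
  forall x, (forall r, 0 < r < 1 -> `|h (x * r)| <= H) ->
  `|\int[mu]_(r in `]0, 1[) (w r * h (x * r))| <= H * \int[mu]_(r in `]0, 1[) w r.
Proof.
move=> iw w0 mh x hH.
have mhx : measurable_fun setT (fun r : R => h (x * r)).
  by apply: measurableT_comp => //; exact: measurable_funM.
have iwh : mu.-integrable `]0, 1[ (EFin \o (fun r => w r * h (x * r))).
  apply: (integrableM_bounded (M := H)) => //; exact: measurable_funTS.
apply: le_trans (le_normr_Rintegral _ iwh) _ => //; rewrite -RintegralZl//.
apply: le_Rintegral => //.
- exact: integrable_norm.
- exact: integrable_EFinZl.
- move=> r /=; rewrite in_itv/= => r01.
  by rewrite normrM (ger0_norm (w0 r)) mulrC ler_wpM2r// hH.
Qed.

(** Unscaled, x^q times the bracket is b x^q + int_0^x (x - s)^q s^q h(s) ds. Against (t - x)^p the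
    first term integrates to b Beta p q, again because p + q + 1 = 0, and the second is
    [Rintegral_triangle]. For p = - alpha and q = alpha - 1 this says that the fractional integrals
    of orders alpha and 1 - alpha compose to the ordinary one. *)
Lemma abel_inversion (p q t H b : R) (h : R -> R) :
  -1 < p <= 0 -> -1 < q <= 0 -> p + q + 1 = 0 -> 0 < t ->
  continuous h -> (forall x, `|h x| <= H) ->
  \int[mu]_(x in `]0, t[) (beta_kernel p q 0 t x * (b + x `^ (q + 1) *
     \int[mu]_(r in `]0, 1[) (beta_kernel q q 0 1 r * h (x * r)))) =
  Beta p q * (b + \int[mu]_(s in `]0, t[) (s `^ q * h s)).
Proof.
move=> pp qq pq t0 ch hH.
have mh : measurable_fun setT h by exact: continuous_measurable_fun.
have iK := integrable_beta_kernel pp qq t0.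
have iw := integrable_beta_kernel01 qq qq.
set I := fun x => \int[mu]_(r in `]0, 1[) (beta_kernel q q 0 1 r * h (x * r)).
have cI : continuous I by exact: (continuous_dilation_integral iw ch hH).
have IH x : `|I x| <= H * Beta q q.
  by apply: dilation_integral_le => // r; exact: beta_kernel_ge0.
have q0 : 0 < q + 1 by case/andP : qq; lra.
have H0 : 0 <= H by apply: le_trans (hH 0).
have i2 : mu.-integrable `]0, t[
    (EFin \o (fun x => beta_kernel p q 0 t x * (x `^ (q + 1) * I x))).
  apply: (integrableM_bounded (M := t `^ (q + 1) * (H * Beta q q))) => //.
    apply: measurable_funTS; apply: measurable_funM; first exact: measurable_powR.
    exact: continuous_measurable_fun.
  move=> x /=; rewrite in_itv/= => /andP[x0 xt]; rewrite normrM ler_pM//.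
  rewrite ger0_norm ?powR_ge0//.
  by apply: ge0_ler_powR; rewrite ?nnegrE; lra.
have i1 : mu.-integrable `]0, t[ (EFin \o (fun x => b * beta_kernel p q 0 t x)).
  exact: integrable_EFinZl.
transitivity (\int[mu]_(x in `]0, t[) (b * beta_kernel p q 0 t x +
    beta_kernel p q 0 t x * (x `^ (q + 1) * I x))).
  by apply: eq_Rintegral => x _; rewrite mulrDr [_ * b]mulrC.
rewrite RintegralD// RintegralZl// mulrDr; congr (_ + _).
  rewrite /Rintegral integral_beta_kernel//= subr0 pq powRr0 mul1r mulrC//.
rewrite -(Rintegral_triangle pp qq pq t0 mh hH).
apply: eq_Rintegral => x; rewrite inE/= in_itv/= => /andP[x0 xt].
rewrite (Rintegral_beta_kernel_scale qq qq x0 mh hH) -/(I x) /beta_kernel subr0.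
rewrite (_ : q + q + 1 = q + (q + 1)); last by ring.
rewrite (@powRD _ x q (q + 1)) ?(gt_eqF x0) ?implybT//; ring.
Qed.
End abel.

(** * Local existence for the classical system *)

Section uniform_limits.
Context {R : realType}.

Definition uniformly_cauchy (V : normedModType R) (u : nat -> R -> V) :=
  forall e, 0 < e -> exists N, forall k l, (N <= k)%N -> (N <= l)%N ->
    forall t, `|u k t - u l t| <= e.

Definition uniformly_converges (V : normedModType R) (u : nat -> R -> V) (v : R -> V) :=
  forall e, 0 < e -> exists N, forall k, (N <= k)%N -> forall t, `|u k t - v t| <= e.

Lemma uniformly_cauchy_converges n (u : nat -> R -> 'rV[R]_n) :
  uniformly_cauchy u -> exists v, uniformly_converges u v.
Proof.
move=> cu; pose v t := lim (u k t @[k --> \oo]).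
have uv t : u k t @[k --> \oo] --> v t.
  apply/cauchy_cvgP/cauchy_ballP => e e0.
  have [N uN] := cu (e / 2) (divr_gt0 e0 (ltr0Sn _ 1)).
  pose A : set 'rV[R]_n := [set y | exists2 k, (N <= k)%N & y = u k t].
  exists (A, A) => /=; first by split; exists N => // k Nk; exists k.
  move=> [_ _] /= [[k Nk ->] [l Nl ->]]; rewrite -ball_normE /=.
  by rewrite (le_lt_trans (uN _ _ Nk Nl t))// ltr_pdivrMr//; lra.
exists v => e e0; have [N uN] := cu e e0; exists N => k Nk t.
have cn : `|u k t - u l t| @[l --> \oo] --> `|u k t - v t|.
  by apply: cvg_norm; apply: cvgB; [exact: cvg_cst|exact: uv].
by apply: (cvgr_to_le cn); exists N => // l Nl; exact: uN.
Qed.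

Lemma continuous_uniform_limit (V : normedModType R) (u : nat -> R -> V) (v : R -> V) :
  (forall k, continuous (u k)) -> uniformly_converges u v -> continuous v.
Proof.
move=> cu uv t; apply/cvgrPdist_le => /= e e0.
have e3 : 0 < e / 3 by rewrite divr_gt0.
have [N uN] := uv _ e3.
have /cvgrPdist_le/(_ _ e3) := cu N t; apply: filterS => s /= us.
rewrite (_ : v t - v s = (v t - u N t) + (u N t - u N s) + (u N s - v s)); last first.
  by rewrite !addrA subrK subrK.
rewrite (le_trans (ler_normD _ _))// (_ : e = e / 3 + e / 3 + e / 3); last by lra.
rewrite lerD ?uN// (le_trans (ler_normD _ _))// lerD//.
by rewrite distrC uN.
Qed.
Lemma half_exp_small (K e : R) : 0 < e -> exists N, K * 2^-1 ^+ N <= e.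
Proof.
move=> e0; exists (Num.bound (`|K| / e)); set N := Num.bound _.
have KN : `|K| / e < N%:R by apply: archi_boundP; rewrite divr_ge0// ltW.
rewrite exprVn ler_pdivrMr ?exprn_gt0// (le_trans (ler_norm K))//.
rewrite mulrC -ler_pdivrMr// (le_trans (ltW KN))//.
by rewrite -natrX ler_nat ltnW// ltn_expl.
Qed.

Lemma uniformly_cauchy_geometric (V : normedModType R) (u : nat -> R -> V) K :
  (forall m k l, (m <= k)%N -> (m <= l)%N ->
    forall t, `|u k t - u l t| <= K * 2^-1 ^+ m) ->
  uniformly_cauchy u.
Proof.
move=> uK e e0; have [N KN] := half_exp_small K e0.
by exists N => k l Nk Nl t; rewrite (le_trans (uK _ _ _ Nk Nl t)).
Qed.

Lemma uniform_limit_ball (V : normedModType R) (u : nat -> R -> V) v X r t :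
  uniformly_converges u v -> (forall k, `|u k t - X| <= r) -> `|v t - X| <= r.
Proof.
move=> uv uX; apply/ler_addgt0Pr => e e0; have [N uN] := uv e e0.
rewrite -[v t](subrK (u N t)) -addrA (le_trans (ler_normD _ _))//.
by rewrite [leRHS]addrC lerD// distrC uN.
Qed.
End uniform_limits.

Section clamp.
Context {R : realType}.

(** Composition with [clamp] freezes a function outside a segment, so that iterates are continuous
    on the whole line and uniform convergence can be stated there without a domain. *)
Definition clamp (a b t : R) : R := Num.max a (Num.min t b).

Lemma continuous_clamp a b : continuous (clamp a b).
Proof.
move=> t; apply: (@continuous_max R R (cst a) (fun t => Num.min t b)).
  exact: cst_continuous.
by apply: (@continuous_min R R id (cst b)); [exact: cvg_id|exact: cst_continuous].
Qed.

Lemma clamp_itv a b t : a <= b -> a <= clamp a b t <= b.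
Proof. by move=> ab; rewrite /clamp le_max lexx ge_max ab ge_min lexx orbT. Qed.

Lemma clamp_id a b t : a <= t <= b -> clamp a b t = t.
Proof. by move=> /andP[at' tb]; rewrite /clamp (min_idPl tb) (max_idPr at'). Qed.
End clamp.

Section picard.
Context {R : realType}.
Notation mu := (@lebesgue_measure R).

Lemma norm_le_of_derive_le (u du : R -> R) (A e : R) :
  (forall t : R, `|t| < A -> is_derive t 1 u (du t)) -> u 0 = 0 ->
  (forall t, `|t| < A -> `|du t| <= e) ->
  forall t, `|t| < A -> `|u t| <= e * `|t|.
Proof.
move=> dU u0 due t tA.
have mvt a b : a <= b -> `|a| < A -> `|b| < A -> `|u b - u a| <= e * (b - a).
  move=> ab aA bA.
  have sub z : z \in `[a, b] -> `|z| < A.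
    by move: aA bA; rewrite in_itv/= !ltr_norml; lra.
  have [||c cab ->] := @MVT_segment R u du a b ab.
  - by move=> z zab; apply: dU; apply: sub; exact: subset_itv_oo_cc.
  - by apply: derivable_within_continuous => z /sub/dU[].
  rewrite normrM (ger0_norm (_ : 0 <= b - a)) ?subr_ge0//.
  by rewrite ler_wpM2r ?subr_ge0// due// sub.
have A0 : `|0 : R| < A by rewrite normr0 (le_lt_trans _ tA).
have [t0|t0] := leP 0 t.
  by have := mvt 0 t t0 A0 tA; rewrite u0 !subr0 (ger0_norm t0).
by have := mvt t 0 (ltW t0) tA A0; rewrite u0 !sub0r normrN (ltr0_norm t0).
Qed.

(** The primitive of g that vanishes at 0. Set integrals carry no orientation, so it is a difference
    of two integrals from - A, which works for both signs of t. *)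
Definition prim n (A : R) (g : R -> 'rV[R]_n) (t : R) : 'rV[R]_n :=
  \row_i (\int[mu]_(s in `[- A, t]) g s ord0 i - \int[mu]_(s in `[- A, 0]) g s ord0 i).

Lemma coordB n (x y : 'rV[R]_n) i : (x - y) ord0 i = x ord0 i - y ord0 i.
Proof. by rewrite !mxE. Qed.

Lemma prim0 n A (g : R -> 'rV[R]_n) : prim A g 0 = 0.
Proof. by apply/rowP => i; rewrite !mxE subrr. Qed.

Lemma is_derive_prim n (A : R) (g : R -> 'rV[R]_n) (t : R) i : continuous g -> `|t| < A ->
  is_derive t 1 (coordinate (prim A g) i) (g t ord0 i).
Proof.
move=> cg; rewrite ltr_norml => /andP[At tA].
have cgi : continuous (fun s => g s ord0 i).
  by move=> s; apply: (@continuous_comp _ _ _ g (fun p => p ord0 i));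
    [exact: cg|exact: coord_continuous].
have ig : mu.-integrable `[- A, A] (EFin \o (fun s => g s ord0 i)).
  by apply: continuous_compact_integrable; [exact: segment_compact|exact: continuous_subspaceT].
have [d1 d2] := continuous_FTC1_closed tA ig At (cgi t).
rewrite /coordinate (_ : (fun s => _) = (fun s => \int[mu]_(z in `[- A, s]) g z ord0 i -
   \int[mu]_(s in `[- A, 0]) g s ord0 i)); last by apply/funext => s; rewrite mxE.
rewrite -[g t ord0 i]subr0.
apply: (@is_deriveB _ _ _ _ (cst _)).
by rewrite -d2 derive1E; exact: derivableP.
Qed.

Lemma picard n (f : 'rV[R]_n -> 'rV[R]_n) (X0 : 'rV[R]_n) : of_class_C1 f ->
  exists2 d, 0 < d & exists2 x : R -> 'rV[R]_n, x 0 = X0 &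
    forall t : R, `|t| < d -> forall i, is_derive t 1 (coordinate x i) (f (x t) ord0 i).
Proof.
move=> C1f; have [L L0 fL] := C1_lipschitz_ball X0 1 C1f.
have cf : continuous f by move=> p; apply: differentiable_continuous; case: C1f.
have [F0 F00 F0E] : exists2 F0, 0 <= F0 & `|f X0| = F0 by exists `|f X0|.
(* Gives (F0 + L) d <= 1, which keeps the iterates in the unit ball around X0, and L d <= 1/2, which
   makes [T] a contraction. *)
pose d := (2 * (F0 + L + 1))^-1.
have d0 : 0 < d by rewrite invr_gt0; lra.
have dFL : (F0 + L) * d <= 1 by rewrite ler_pdivrMr; lra.
have dL : L * d <= 2^-1 by rewrite ler_pdivrMr; lra.
(* The clamped times lie in [- d, d], strictly inside ]- A, A[, where [prim] is differentiable. *)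
pose A := 2 * d; pose c := clamp (- d) d.
have cd t : `|c t| <= d by rewrite ler_norml clamp_itv; lra.
have cA t : `|c t| < A by rewrite (le_lt_trans (cd t))// /A; lra.
have cc : continuous c by exact: continuous_clamp.
pose T (x : R -> 'rV[R]_n) t := X0 + prim A (f \o x) (c t).
have cT x : continuous x -> continuous (T x).
  move=> cx t.
  apply: (@continuousD _ _ _ (cst X0) (fun t => prim A (f \o x) (c t))).
    exact: cst_continuous.
  apply: continuous_comp; first exact: cc.
  apply: differentiable_continuous; apply/derivable1_diffP/derivable_mxP => i j.
  rewrite (ord1 i).
  have [] // := @is_derive_prim n A (f \o x) (c t) j _ (cA t).
  by move=> s; apply: continuous_comp; [exact: cx|exact: cf].
have Tdist (x y : R -> 'rV[R]_n) (e : R) : continuous x -> continuous y -> 0 <= e ->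
    (forall t, `|x t - X0| <= 1) -> (forall t, `|y t - X0| <= 1) ->
    (forall t, `|x t - y t| <= e) -> forall t, `|T x t - T y t| <= e / 2.
  move=> cx cy e0 x1 y1 xy t; apply: norm_le_coord => [|i j]; first by rewrite divr_ge0.
  rewrite (ord1 i) /T opprD addrACA subrr add0r coordB.
  have := @norm_le_of_derive_le (fun s => prim A (f \o x) s ord0 j - prim A (f \o y) s ord0 j)
    (fun s => f (x s) ord0 j - f (y s) ord0 j) A (L * e) _ _ _ (c t) (cA t).
  move=> H; apply: le_trans (H _ _ _) _.
  - move=> s sA; apply: is_deriveB; apply: is_derive_prim => //.
      by move=> z; apply: continuous_comp; [exact: cx|exact: cf].
    by move=> z; apply: continuous_comp; [exact: cy|exact: cf].
  - by rewrite /= !prim0 subrr.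
  - move=> s _; have := norm_coord_le (f (x s) - f (y s)) ord0 j; rewrite coordB => /le_trans.
    by apply; rewrite (le_trans (fL _ _ (x1 s) (y1 s)))// ler_wpM2l.
  - by rewrite mulrAC [leRHS]mulrC ler_wpM2r// (le_trans _ dL)// ler_wpM2l.
have Tball (x : R -> 'rV[R]_n) : continuous x -> (forall t, `|x t - X0| <= 1) -> forall t, `|T x t - X0| <= 1.
  move=> cx x1 t; rewrite /T addrC addKr; apply: norm_le_coord => // i j.
  rewrite (ord1 i) {i}.
  have := @norm_le_of_derive_le (fun s => prim A (f \o x) s ord0 j)
    (fun s => f (x s) ord0 j) A (`|f X0| + L) _ _ _ (c t) (cA t).
  move=> H; apply: le_trans (H _ _ _) _.
  - move=> s sA; apply: is_derive_prim => //.
    by move=> z; apply: continuous_comp; [exact: cx|exact: cf].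
  - by rewrite /= prim0 mxE.
  - move=> s _; rewrite (le_trans (norm_coord_le _ _ _))//.
    rewrite -[f (x s)](subrK (f X0)) addrC (le_trans (ler_normD _ _))// lerD2l.
    have X01 : `|X0 - X0| <= 1 by rewrite subrr normr0.
    by rewrite (le_trans (fL _ _ (x1 s) X01))// -[leRHS]mulr1 ler_wpM2l.
  - by rewrite F0E (le_trans _ dFL)// ler_wpM2l//; lra.
pose u k := iter k T (cst X0).
have cu k : continuous (u k).
  by elim: k => [|k ih]; [exact: cst_continuous|exact: cT].
have u1 k t : `|u k t - X0| <= 1.
  by elim: k t => [|k ih] t; [rewrite /= subrr normr0|exact: Tball].
have ucauchy m k l : (m <= k)%N -> (m <= l)%N -> forall t, `|u k t - u l t| <= 2 * 2^-1 ^+ m.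
  elim: m k l => [|m ih] k l mk ml t.
    rewrite expr0 mulr1 -[u k t](subrK X0) -addrA (le_trans (ler_normD _ _))//.
    by have := u1 k t; have := u1 l t; rewrite distrC; lra.
  case: k mk => // k mk; case: l ml => // l ml.
  rewrite exprS mulrCA mulrC; apply: Tdist => //; last by move=> s; exact: ih.
have uC : uniformly_cauchy u by exact: uniformly_cauchy_geometric ucauchy.
have [x ux] := uniformly_cauchy_converges uC.
have cx := continuous_uniform_limit cu ux.
have x1 t : `|x t - X0| <= 1 by exact: uniform_limit_ball ux _.
have xT t : x t = T x t.
  apply/eqP; rewrite -subr_eq0 -normr_le0; apply/ler_addgt0Pr => e e0; rewrite add0r.
  have e2 : 0 < e / 2 by rewrite divr_gt0.
  have [N uN] := ux _ e2.
  rewrite -[x t](subrK (u N.+1 t)) -addrA (le_trans (ler_normD _ _))//.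
  have : `|T (u N) t - T x t| <= e / 2 / 2.
    by apply: Tdist => //; [exact: ltW|exact: uN].
  by have := uN N.+1 (leqnSn N) t; rewrite distrC /=; lra.
exists d => //; exists x.
  by rewrite xT /T /c clamp_id ?prim0 ?addr0//; lra.
move=> t td i.
have ctt : c t = t by apply: clamp_id; move: td; rewrite ltr_norml; lra.
rewrite (_ : coordinate x i = cst (X0 ord0 i) \+ coordinate (fun s => prim A (f \o x) (c s)) i); last first.
  by apply/funext => s; rewrite /coordinate xT mxE.
rewrite -[f (x t) ord0 i]add0r; apply: is_deriveD.
have tA : `|t| < A by rewrite (lt_trans td)// /A; lra.
have cfx : continuous (f \o x).
  by move=> z; apply: continuous_comp; [exact: cx|exact: cf].
apply: near_eq_is_derive (is_derive_prim i cfx tA).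
have : t \in `]- d, d[ by rewrite in_itv/= -ltr_norml.
move=> /near_in_itvoo; apply: filterS => z; rewrite in_itv/= => zd.
by rewrite /coordinate /c clamp_id//; lra.
Qed.

Lemma tangent_of_classical_invariant n (f : 'rV[R]_n -> 'rV[R]_n) a c :
  of_class_C1 f -> classical_invariant f [set x | dot a x = c] -> tangent f a c.
Proof.
move=> C1f inv X0 SX0; have [d d0 [x x0 dx]] := picard X0 C1f.
have ltd t : (((- d)%:E < t%:E)%E -> (t%:E < d%:E)%E -> `|t| < d).
  by rewrite !lte_fin => dt td; rewrite ltr_norml dt.
have Sx := inv X0 (- d)%:E d%:E x SX0.
have {}Sx t : `|t| < d -> dot a (x t) - c = 0.
  rewrite ltr_norml => /andP[dt td]; apply/eqP; rewrite subr_eq0; apply/eqP.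
  apply: Sx; rewrite ?lte_fin//; split; rewrite ?lte_fin ?oppr_lt0// => s ds sd i.
  by apply: dx; exact: ltd.
have d00 : `|0 : R| < d by rewrite normr0.
have := is_derive_dot a c (dx 0 d00); rewrite x0 -/(dot a (f X0)) => h.
have /@derive_val <- := h.
rewrite -[RHS](derive_cst (0 : R) (0 : R) 1); apply: near_eq_derive.
have : (0 : R) \in `]- d, d[ by rewrite in_itv/= oppr_lt0 d0.
by move=> /near_in_itvoo; apply: filterS => z; rewrite in_itv/= -ltr_norml => /Sx.
Qed.
End picard.

(** * Local existence for the fractional system *)

Section weighted_primitive.
Context {R : realType}.
Notation mu := (@lebesgue_measure R).

(** With q = alpha - 1 and h = v this recovers x - X0 from v = t^(1 - alpha) x'. *)
Definition wprim (q : R) (h : R -> R) (t : R) : R :=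
  \int[mu]_(s in `]0, t[) (s `^ q * h s).

Context (q : R) (q1 : -1 < q <= 0) (h : R -> R) (H : R).
Hypotheses (ch : continuous h) (hH : forall x, `|h x| <= H).

Lemma integrable_weighted t : 0 < t ->
  mu.-integrable `]0, t[ (EFin \o (fun s => s `^ q * h s)).
Proof.
move=> t0; apply: (integrableM_bounded (M := H)) => //.
  by apply: measurable_funTS; exact: continuous_measurable_fun.
by apply: integrable_powR_oo => //; case/andP : q1.
Qed.

Lemma wprim_le0 t : t <= 0 -> wprim q h t = 0.
Proof. by move=> t0; rewrite /wprim set_itv_ge ?Rintegral_set0// bnd_simp -leNgt. Qed.

Lemma norm_wprim_le t : 0 <= t -> `|wprim q h t| <= H * (t `^ (q + 1) / (q + 1)).
Proof.
rewrite le_eqVlt => /predU1P[<-|t0].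
  rewrite wprim_le0// normr0 mulr_ge0//; first exact: le_trans (hH 0).
  by rewrite divr_ge0 ?powR_ge0//; case/andP : q1; lra.
have q1' : -1 < q by case/andP : q1.
apply: le_trans (le_normr_Rintegral _ (integrable_weighted t0)) _ => //.
rewrite -Rintegral_powR_oo ?(ltW t0)// -RintegralZl//; last exact: integrable_powR_oo.
apply: le_Rintegral => //.
- by apply: integrable_norm; exact: integrable_weighted.
- by apply: integrable_EFinZl => //; exact: integrable_powR_oo.
- by move=> s _; rewrite normrM ger0_norm ?powR_ge0// mulrC ler_wpM2r ?powR_ge0.
Qed.

Lemma is_derive_wprim (t : R) : 0 < t -> is_derive t 1 (wprim q h) (t `^ q * h t).
Proof.
move=> t0; have ti : t < t + 1 by lra.
have iw := integrable_itv_oo_cc (integrable_weighted (t := t + 1) (lt_trans t0 ti)).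
have cw : {for t, continuous (fun s => s `^ q * h s)}.
  apply: cvgM; last exact: ch.
  by have [/derivable1_diffP/differentiable_continuous + _] := is_derive1_powR q t0.
have [d1 d2] := continuous_FTC1_closed ti iw t0 cw.
rewrite -d2 derive1E; apply: near_eq_is_derive (derivableP d1).
have : t \in `]0, t + 1[ by rewrite in_itv/= t0.
move=> /near_in_itvoo; apply: filterS => s; rewrite in_itv/= => /andP[s0 _].
rewrite /wprim /Rintegral (integral_itv_bndoo true false)//.
by case/integrableP : (integrable_weighted s0).
Qed.

(** At 0 the singular weight rules out differentiability arguments: the function is 0 on the left,
    and on the right it is squeezed by H t^(q+1) / (q+1). *)
Lemma continuous_wprim : continuous (wprim q h).
Proof.
have q0 : 0 < q + 1 by case/andP : q1; lra.
move=> t; have [t0|t0|->] := ltgtP t 0.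
- have : (fun=> 0 : R) @ t --> wprim q h t by rewrite wprim_le0 ?ltW//; exact: cvg_cst.
  apply: cvg_trans; apply: near_eq_cvg; near=> s.
  rewrite wprim_le0// ltW//; near: s; exact: lt_nbhsl.
- by have [/derivable1_diffP/differentiable_continuous] := is_derive_wprim t0.
apply/left_right_continuousP; split.
  rewrite wprim_le0//.
  have : (fun=> 0 : R) @ (0 : R)^'- --> (0 : R) by exact: cvg_cst.
  apply: cvg_trans; apply: near_eq_cvg; near=> s.
  by rewrite wprim_le0// ltW//; near: s; exact: nbhs_left_lt.
rewrite wprim_le0//; apply/norm_cvg0P.
have b0 : H * (s `^ (q + 1) / (q + 1)) @[s --> 0^'+] --> (0 : R).
  rewrite -[X in _ --> X](mulr0 H) -[X in _ --> H * X](mul0r (q + 1)^-1).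
  apply: cvgM; first exact: cvg_cst.
  by apply: cvgM; [exact: powR_cvg0|exact: cvg_cst].
apply: (@squeeze_cvgr _ _ _ _ (cst 0) (fun s => H * (s `^ (q + 1) / (q + 1)))); last 2 first.
- exact: cvg_cst.
- exact: b0.
near=> s; rewrite normr_ge0/=; apply: norm_wprim_le; apply: ltW.
by near: s; exact: nbhs_right_gt.
Unshelve. all: by end_near. Qed.
End weighted_primitive.

Lemma wprimB {R : realType} (q H : R) (h k : R -> R) t : -1 < q <= 0 -> 0 <= t ->
  continuous h -> (forall x, `|h x| <= H) -> continuous k -> (forall x, `|k x| <= H) ->
  wprim q h t - wprim q k t = wprim q (fun x => h x - k x) t.
Proof.
move=> q1; rewrite le_eqVlt => /predU1P[<-|t0] ch hH ck kH.
  by rewrite !wprim_le0// subrr.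
rewrite /wprim -RintegralB//; try exact: (integrable_weighted q1 _ _ t0).
by apply: eq_Rintegral => s _; rewrite mulrBr.
Qed.

Section continuous_coordinates.
Context {R : realType}.

Lemma continuous_coord m n (T : topologicalType) (g : T -> 'M[R]_(m, n)) i j :
  continuous g -> continuous (fun t => g t i j).
Proof.
by move=> cg t; apply: (@continuous_comp _ _ _ g (fun A => A i j));
  [exact: cg|exact: coord_continuous].
Qed.

Lemma continuous_of_coord n (T : topologicalType) (g : T -> 'rV[R]_n) :
  (forall i, continuous (fun t => g t ord0 i)) -> continuous g.
Proof.
move=> cg t; apply/cvgrPdist_le => /= e e0.
have : \forall s \near t, forall i, `|g t ord0 i - g s ord0 i| <= e.
  apply: filter_forall => i; have /cvgrPdist_le := cg i t.
  exact.
apply: filterS => s gs; apply: norm_le_coord => [|i j]; first exact: ltW.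
by rewrite (ord1 i) !mxE.
Qed.

Lemma continuous_mulmx_rV n (T : topologicalType) (v : T -> 'rV[R]_n) (J : T -> 'M[R]_n) :
  continuous v -> continuous J -> continuous (fun t => v t *m J t).
Proof.
move=> cv cJ; apply: continuous_of_coord => i.
rewrite (_ : (fun t => _) = (fun t => \sum_(j < n) v t ord0 j * J t j i)); last first.
  by apply/funext => t; rewrite mxE.
apply: continuous_big => [|j _ t]; first exact: add_continuous.
by apply: (@continuousM _ _ (fun t => v t ord0 j) (fun t => J t j i));
  apply: continuous_coord.
Qed.
End continuous_coordinates.

(** At a point m where |u| is maximal on [0, t] the extremum principle gives m^(-alpha) |u m| <= E,
    and m <= d. Thus u is bounded by its Caputo integral with a small factor d^alpha, which is the
    source of the contraction of x. *)
Lemma norm_le_of_caputo_le {R : realType} (alpha d M E : R) (u g : R -> R) :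
  0 < alpha < 1 -> continuous u -> u 0 = 0 -> continuous g -> (forall s, `|g s| <= M) ->
  (forall s : R, 0 < s < d -> is_derive s 1 u (s `^ (alpha - 1) * g s)) ->
  (forall t, 0 < t < d -> `|\int[@lebesgue_measure R]_(s in `]0, t[)
     ((t - s) `^ (- alpha) * (s `^ (alpha - 1) * g s))| <= E) ->
  forall t, 0 <= t < d -> `|u t| <= d `^ alpha * E.
Proof.
move=> a01 cu u0 cg gM du IE t /andP[t0 td].
have a0 : 0 < alpha by case/andP : a01.
have pp : -1 < - alpha <= 0 by lra.
have qq : -1 < alpha - 1 <= 0 by lra.
have d0 : 0 < d by exact: le_lt_trans td.
have E0 : 0 <= E by apply: le_trans (IE (d / 2) _) => //; lra.
have cnu : {within `[0, t], continuous (fun s => `|u s|)}.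
  apply: continuous_subspaceT => s; apply: continuous_comp; first exact: cu.
  exact: norm_continuous.
have [m + maxm] := EVT_max t0 cnu; rewrite in_itv/= => /andP[m0 mt].
apply: (@le_trans _ _ `|u m|); first by apply: maxm; rewrite in_itv/= t0 lexx.
move: m0; rewrite le_eqVlt => /predU1P[<-|m0].
  by rewrite u0 normr0 mulr_ge0// powR_ge0.
have md : 0 < m < d by rewrite m0 (le_lt_trans mt).
have [um0|um0] := eqVneq (u m) 0; first by rewrite um0 normr0 mulr_ge0// powR_ge0.
pose sg := Num.sg (u m).
have sgu : sg * u m = `|u m| by rewrite /sg -normrEsg.
pose D s := s `^ (alpha - 1) * g s.
have iD : (@lebesgue_measure R).-integrable `]0, m[
    (EFin \o (fun s => (m - s) `^ (- alpha) * D s)).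
  have : (@lebesgue_measure R).-integrable `]0, m[
      (EFin \o (fun s => beta_kernel (- alpha) (alpha - 1) 0 m s * g s)).
    apply: (integrableM_bounded (M := M)) => //; last exact: integrable_beta_kernel.
    by apply: measurable_funTS; exact: continuous_measurable_fun.
  by apply: eq_integrable => // s _ /=; rewrite /beta_kernel subr0 mulrA.
have MP : (m - 0) `^ (- alpha) * (sg * u m - sg * u 0) <=
    \int[@lebesgue_measure R]_(s in `]0, m[) ((m - s) `^ (- alpha) * (sg * D s)).
  apply: (@weighted_derive_ge_increment R alpha (fun s => sg * u s) (fun s => sg * D s)) => //.
  - apply: continuous_subspaceT => s.
    by apply: (@continuousM _ _ (cst sg) u); [exact: cst_continuous|exact: cu].
  - move=> s /andP[s0 sm]; have sd : 0 < s < d by rewrite s0 (le_lt_trans sm)//; case/andP: md.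
    by apply: is_deriveZ; exact: du.
  - move=> s /andP[s0 _]; apply: cvgM; first exact: cvg_cst.
    apply: cvgM; last exact: cg.
    by have [/derivable1_diffP/differentiable_continuous + _] := is_derive1_powR (alpha - 1) s0.
  - have : (@lebesgue_measure R).-integrable `]0, m[
        (EFin \o (fun s => sg * ((m - s) `^ (- alpha) * D s))).
      exact: integrable_EFinZl.
    by apply: eq_integrable => // s _ /=; rewrite mulrCA.
  - move=> s /andP[s0 sm]; rewrite sgu.
    apply: le_trans (maxm s _); last by rewrite in_itv/= s0 (le_trans sm).
    by rewrite (le_trans (ler_norm _))// normrM normr_sg um0 mul1r.
have Esg : \int[@lebesgue_measure R]_(s in `]0, m[) ((m - s) `^ (- alpha) * (sg * D s)) =
    sg * \int[@lebesgue_measure R]_(s in `]0, m[) ((m - s) `^ (- alpha) * D s).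
  by rewrite -RintegralZl//; apply: eq_Rintegral => s _; rewrite mulrCA.
rewrite Esg sgu u0 mulr0 !subr0 in MP.
have {}MP : m `^ (- alpha) * `|u m| <= E.
  apply: (le_trans MP); rewrite (le_trans (ler_norm _))// normrM normr_sg um0 mul1r.
  exact: IE.
rewrite powRN ler_pdivrMl ?powR_gt0// in MP; apply: (le_trans MP).
rewrite ler_wpM2r//; apply: (ge0_ler_powR (ltW a0)); rewrite ?nnegrE ?(ltW m0) ?(ltW d0)//.
by rewrite (le_trans mt)// ltW.
Qed.

(** * The iteration on the weighted derivative v *)

Section fractional_existence.
Context {R : realType} (n : nat) (alpha : R) (f : 'rV[R]_n -> 'rV[R]_n) (X0 : 'rV[R]_n).
Context (b d : R).
Notation mu := (@lebesgue_measure R).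
Notation q := (alpha - 1).
Notation p := (- alpha).

Let W : R := Beta q q.
Let G : R := Gamma (1 - alpha).
(** Equal to 1 / Gamma(alpha), because B(1 - alpha, alpha) = Gamma(1 - alpha) Gamma(alpha). It is
    kept as the quotient in which Abel inversion produces it. *)
Let kap : R := G / Beta p q.
Let M : R := kap * `|f X0| + 1.
Let c : R -> R := clamp 0 d.

(* The locks keep unification from unfolding nested iterates down to integrals. *)
Definition xof : (R -> 'rV[R]_n) -> R -> 'rV[R]_n :=
  locked (fun v t => X0 + \row_i wprim q (fun s => v s ord0 i) (c t)).

Definition hof : (R -> 'rV[R]_n) -> R -> 'rV[R]_n :=
  locked (fun v t => v t *m 'J f (xof v t)).

Definition avg : (R -> 'rV[R]_n) -> R -> 'rV[R]_n :=
  locked (fun w t =>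
    \row_i \int[mu]_(r in `]0, 1[) (beta_kernel q q 0 1 r * w (t * r) ord0 i)).

(** The right-hand side of the equation for v, with time frozen outside [0, d] by [c]. *)
Definition vof : (R -> 'rV[R]_n) -> R -> 'rV[R]_n :=
  locked (fun v t => kap *: (f X0 + (c t) `^ alpha *: avg (hof v) (c t))).

Definition good (v : R -> 'rV[R]_n) := continuous v /\ forall t, `|v t| <= M.

Hypotheses (a01 : 0 < alpha < 1) (C1f : of_class_C1 f) (b0 : 0 <= b) (d0 : 0 < d).
Hypothesis Jb : forall z, `|z - X0| <= 1 -> forall i j, `|'J f z i j| <= b.
(** The three conditions make d small: [d1] keeps [xof v] in the unit ball where [Jb] holds, [d2]
    preserves the bound [M] on v and halves the part of the error linear in v, [d3] halves the
    distance between the x's. *)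
Hypothesis d1 : M * (d `^ alpha / alpha) <= 1.
Hypothesis d2 : kap * d `^ alpha * W * n%:R * M * b <= 2^-1.
Hypothesis d3 : d `^ alpha * (G * (n%:R * b)) <= 2^-1.

Let pp : -1 < p <= 0. Proof. by case/andP : a01; lra. Qed.
Let qq : -1 < q <= 0. Proof. by case/andP : a01; lra. Qed.
Let pq : p + q + 1 = 0. Proof. by ring. Qed.
Let q1E : q + 1 = alpha. Proof. by ring. Qed.
Let a0 : 0 < alpha. Proof. by case/andP : a01. Qed.
Let G0 : 0 < G. Proof. by apply: Gamma_gt0; case/andP : a01; lra. Qed.
Let B0 : 0 < Beta p q. Proof. exact: Beta_gt0. Qed.
Let W0 : 0 < W. Proof. exact: Beta_gt0. Qed.
Let kap0 : 0 < kap. Proof. by rewrite /kap divr_gt0. Qed.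
Let M1 : 1 <= M. Proof. by rewrite lerDr mulr_ge0// ltW. Qed.
Let M0 : 0 <= M. Proof. exact: le_trans ler01 M1. Qed.
Let df : forall z, differentiable f z. Proof. by case: C1f. Qed.
Let c0d t : 0 <= c t <= d. Proof. by apply: clamp_itv; exact: ltW. Qed.
Let cc : continuous c. Proof. exact: continuous_clamp. Qed.

Let c_powR t : (c t) `^ alpha <= d `^ alpha.
Proof.
have /andP[c0 cd] := c0d t.
by apply: (ge0_ler_powR (ltW a0)); rewrite ?nnegrE// ltW.
Qed.

Lemma xofE v t i : xof v t ord0 i = X0 ord0 i + wprim q (fun s => v s ord0 i) (c t).
Proof. by rewrite /xof -lock !mxE. Qed.

Lemma hofE v t : hof v t = v t *m 'J f (xof v t).
Proof. by rewrite /hof -lock. Qed.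

Lemma avgE w t i : avg w t ord0 i =
  \int[mu]_(r in `]0, 1[) (beta_kernel q q 0 1 r * w (t * r) ord0 i).
Proof. by rewrite /avg -lock mxE. Qed.

Lemma vofE v t i : vof v t ord0 i =
  kap * (f X0 ord0 i + (c t) `^ alpha * avg (hof v) (c t) ord0 i).
Proof. by rewrite /vof -lock !mxE. Qed.

Lemma xof0 v : xof v 0 = X0.
Proof.
apply/rowP => i; rewrite xofE /c clamp_id ?wprim_le0 ?addr0//.
by rewrite lexx ltW.
Qed.

Section good.
Context (v : R -> 'rV[R]_n) (gv : good v).

Let cv i : continuous (fun s => v s ord0 i).
Proof. by apply: continuous_coord; case: gv. Qed.

Let vM i s : `|v s ord0 i| <= M.
Proof. by case: gv => _ vM; exact: le_trans (norm_coord_le _ _ _) (vM _). Qed.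

Lemma continuous_xof : continuous (xof v).
Proof.
apply: continuous_of_coord => i.
rewrite (_ : (fun t => _) = (fun t => X0 ord0 i + wprim q (fun s => v s ord0 i) (c t))); last first.
  by apply/funext => t; rewrite xofE.
move=> t; apply: (@continuousD _ _ _ (cst (X0 ord0 i)) (fun t => wprim q (fun s => v s ord0 i) (c t))).
  exact: cst_continuous.
apply: (@continuous_comp _ _ _ c (wprim q (fun s => v s ord0 i))); first exact: cc.
exact: (continuous_wprim qq (@cv i) (vM i)).
Qed.

Lemma xof_ball t : `|xof v t - X0| <= 1.
Proof.
apply: norm_le_coord => // k i; rewrite (ord1 k) coordB xofE addrC addKr.
have /andP[ct0 _] := c0d t.
rewrite (le_trans (norm_wprim_le qq (@cv i) (vM i) ct0))// q1E (le_trans _ d1)//.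
by rewrite ler_wpM2l// ler_pM2r ?invr_gt0.
Qed.

Lemma continuous_hof : continuous (hof v).
Proof.
rewrite (_ : hof v = fun t => v t *m 'J f (xof v t)); last first.
  by apply/funext => t; rewrite hofE.
apply: continuous_mulmx_rV; first by case: gv.
move=> t; apply: continuous_comp; first exact: continuous_xof.
exact: (proj2 C1f).
Qed.

Lemma norm_hof_coord_le t i : `|hof v t ord0 i| <= n%:R * (M * b).
Proof.
rewrite hofE; apply: norm_mulmx_coord_le; first by case: gv.
exact: Jb (xof_ball t).
Qed.

Let iw := integrable_beta_kernel01 qq qq.

Lemma continuous_vof : continuous (vof v).
Proof.
apply: continuous_of_coord => i.
rewrite (_ : (fun t => _) = (fun t => kap * (f X0 ord0 i + (c t) `^ alpha * avg (hof v) (c t) ord0 i))); last first.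
  by apply/funext => t; rewrite vofE.
move=> t; apply: (@continuousM _ _ (cst kap) (fun t => f X0 ord0 i +
    (c t) `^ alpha * avg (hof v) (c t) ord0 i)); first exact: cst_continuous.
apply: (@continuousD _ _ _ (cst (f X0 ord0 i)) (fun t =>
    (c t) `^ alpha * avg (hof v) (c t) ord0 i)); first exact: cst_continuous.
apply: (@continuousM _ _ (fun t => c t `^ alpha) (fun t => avg (hof v) (c t) ord0 i)).
  (* [powR] is not continuous at 0, but [x ^ alpha / alpha] is a primitive on the right. *)
  rewrite (_ : (fun t => c t `^ alpha) = (fun t => alpha * wprim q (fun=> 1) (c t))); last first.
    apply/funext => s; rewrite /wprim; under eq_Rintegral do rewrite mulr1.
    have /andP[cs0 _] := c0d s.
    rewrite Rintegral_powR_oo ?q1E//; first by rewrite mulrC divfK// gt_eqF.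
    by case/andP : qq.
  apply: (@continuousM _ _ (cst alpha) (fun s => wprim q (fun=> 1) (c s))).
    exact: cst_continuous.
  apply: (@continuous_comp _ _ _ c (wprim q (fun=> 1))); first exact: cc.
  apply: (continuous_wprim qq (H := 1)) => [x|x]; first exact: cst_continuous.
  by rewrite normr1.
apply: (@continuous_comp _ _ _ c (fun t => avg (hof v) t ord0 i)); first exact: cc.
rewrite (_ : (fun t => _) = fun t => \int[mu]_(r in `]0, 1[)
    (beta_kernel q q 0 1 r * hof v (t * r) ord0 i)).
  by apply: (continuous_dilation_integral iw (continuous_coord continuous_hof) (fun x => norm_hof_coord_le x i)).
by apply/funext => s; rewrite avgE.
Qed.

Lemma integrable_avg t i : mu.-integrable `]0, 1[
  (EFin \o (fun r => beta_kernel q q 0 1 r * hof v (t * r) ord0 i)).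
Proof.
have mh : measurable_fun setT (fun r : R => hof v (t * r) ord0 i).
  apply: (measurableT_comp (f := fun s => hof v s ord0 i)).
    by apply: continuous_measurable_fun; exact: continuous_coord continuous_hof.
  exact: measurable_funM.
apply: (integrableM_bounded (M := n%:R * (M * b))) => //.
  exact: measurable_funTS.
by move=> r _; exact: norm_hof_coord_le.
Qed.

Lemma norm_avg_le (w : R -> 'rV[R]_n) e t : continuous w ->
  (forall s i, 0 <= s < d -> `|w s ord0 i| <= e) ->
  forall i, `|avg w (c t) ord0 i| <= e * W.
Proof.
move=> cw we i; rewrite avgE.
apply: (dilation_integral_le (h := fun s => w s ord0 i) iw).
- by move=> r; exact: beta_kernel_ge0.
- by apply: continuous_measurable_fun; exact: continuous_coord.
move=> r /andP[r0 r1]; apply: we.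
by have /andP[ct0 ctd] := c0d t; rewrite mulr_ge0 ?(ltW r0)//= (le_lt_trans (ler_wpM2r (ltW r0) ctd))// gtr_pMr.
Qed.

Lemma vof_le t : `|vof v t| <= M.
Proof.
apply: norm_le_coord => // k i; rewrite (ord1 k) vofE normrM gtr0_norm//.
have hle := @norm_avg_le (hof v) _ t continuous_hof (fun s i _ => norm_hof_coord_le s i) i.
rewrite (@le_trans _ _ (kap * (`|f X0| + d `^ alpha * (n%:R * (M * b) * W))))//.
  rewrite ler_pM2l// (le_trans (ler_normD _ _))// lerD ?norm_coord_le//.
  by rewrite normrM ler_pM// ger0_norm ?powR_ge0.
rewrite mulrDr lerD2l (_ : kap * _ = kap * d `^ alpha * W * n%:R * M * b); last by ring.
by apply: le_trans d2 _; lra.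
Qed.

Lemma integrable_kernel_good t i : 0 < t ->
  mu.-integrable `]0, t[ (EFin \o (fun s => (t - s) `^ p * (s `^ q * v s ord0 i))).
Proof.
move=> t0; have : mu.-integrable `]0, t[ (EFin \o (fun s => beta_kernel p q 0 t s * v s ord0 i)).
  apply: (integrableM_bounded (M := M)) => //; last exact: integrable_beta_kernel.
  by apply: measurable_funTS; exact: continuous_measurable_fun.
by apply: eq_integrable => // s _ /=; rewrite /beta_kernel subr0 mulrA.
Qed.

Lemma good_vof : good (vof v).
Proof. by split; [exact: continuous_vof|exact: vof_le]. Qed.

Lemma is_derive_xof t i : 0 < t < d ->
  is_derive t 1 (coordinate (xof v) i) (t `^ q * v t ord0 i).
Proof.
move=> td; have /andP[t0 _] := td.
have h := is_derive_wprim qq (@cv i) (vM i) t0.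
have {}h : is_derive t 1 (fun s => X0 ord0 i + wprim q (fun s => v s ord0 i) s)
    (0 + t `^ q * v t ord0 i).
  exact: (@is_deriveD _ _ _ (cst (X0 ord0 i))).
rewrite add0r in h; apply: near_eq_is_derive h.
have : t \in `]0, d[ by rewrite in_itv.
move=> /near_in_itvoo; apply: filterS => s; rewrite in_itv/= => /andP[s0 sd].
by rewrite /coordinate xofE /c clamp_id// !ltW.
Qed.

(** By the chain rule s^(alpha-1) [hof v s] is the derivative of f(xof v s) on ]0, d[, and [xof v]
    starts at X0. *)
Lemma wprim_hof t i : 0 < t < d ->
  wprim q (fun s => hof v s ord0 i) t = f (xof v t) ord0 i - f X0 ord0 i.
Proof.
move=> /andP[t0 td].
have ch : continuous (fun s => hof v s ord0 i) by exact: continuous_coord continuous_hof.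
have cF : continuous (fun s => f (xof v s) ord0 i).
  apply: continuous_coord => s; apply: continuous_comp; first exact: continuous_xof.
  exact: differentiable_continuous.
rewrite -(xof0 v); apply: (@open_FTC R _ (fun s => f (xof v s) ord0 i)) => //.
- exact: (integrable_weighted qq ch (fun s => norm_hof_coord_le s i)).
- move=> s /andP[s0 _]; apply: cvgM; last exact: ch.
  by have [/derivable1_diffP/differentiable_continuous + _] := is_derive1_powR q s0.
- move=> s /andP[s0 st]; have sd : 0 < s < d by rewrite s0 (lt_trans st).
  have h k : is_derive s 1 (fun s => xof v s ord0 k) ((s `^ q *: v s) ord0 k).
    by rewrite mxE; exact: is_derive_xof.
  apply: is_derive_eq (is_derive_comp_C1 df h i) _.
  by rewrite -scalemxAl mxE hofE.
- by apply: cvg_at_right_filter; exact: cF.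
- by apply: cvg_at_left_filter; exact: cF.
Qed.

(** Abel inversion with b = f(X0) and h = [hof v]: by [wprim_hof] the bracket b + int_0^t s^q h(s)
    ds is f(xof v t), and [kap] turns the factor Beta p q into G. *)
Lemma caputo_xof_vof t i : 0 < t < d ->
  \int[mu]_(s in `]0, t[) ((t - s) `^ p * (s `^ q * vof v s ord0 i)) =
  G * f (xof v t) ord0 i.
Proof.
move=> td; have /andP[t0 tltd] := td.
have ch : continuous (fun s => hof v s ord0 i) by exact: continuous_coord continuous_hof.
have := abel_inversion (f X0 ord0 i) pp qq pq t0 ch (fun s => norm_hof_coord_le s i).
rewrite -[X in _ = _ * (_ + X)]/(wprim q (fun s => hof v s ord0 i) t) wprim_hof// subrKC => E.
transitivity (kap * (Beta p q * f (xof v t) ord0 i)); last first.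
  by rewrite mulrA /kap divfK// gt_eqF.
rewrite -E -RintegralZl//; last first.
  have : mu.-integrable `]0, t[ (EFin \o (fun s => beta_kernel p q 0 t s *
      (kap^-1 * vof v s ord0 i))).
    apply: (integrableM_bounded (M := kap^-1 * M)) => //.
    - apply: measurable_funTS; apply: measurable_funM => //.
      by apply: continuous_measurable_fun; apply: continuous_coord; exact: continuous_vof.
    - move=> s _; rewrite normrM gtr0_norm ?invr_gt0// ler_pM2l ?invr_gt0//.
      by rewrite (le_trans (norm_coord_le _ _ _))// vof_le.
    - exact: integrable_beta_kernel.
  apply: eq_integrable => // s; rewrite inE/= in_itv/= => /andP[s0 st].
  rewrite vofE /c clamp_id; last by rewrite ltW//= ltW// (lt_trans st).
  by rewrite /= q1E avgE mulKf ?gt_eqF.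
apply: eq_Rintegral => s; rewrite inE/= in_itv/= => /andP[s0 st].
rewrite vofE /c clamp_id; last by rewrite ltW//= ltW// (lt_trans st).
by rewrite q1E /beta_kernel subr0 avgE; ring.
Qed.
End good.

(** The difference of the new x's has Caputo integral G (f(xof v) - f(xof w)), at most G n b e in
    absolute value in each coordinate; the factor d^alpha and [d3] bring this to e / 2. The distance
    assumed is that of the x's, not of v and w: no modulus of continuity of Df enters. *)
Lemma xof_contraction v w e : good v -> good w -> 0 <= e ->
  (forall s, 0 <= s < d -> `|xof v s - xof w s| <= e) ->
  forall t, 0 <= t < d -> `|xof (vof v) t - xof (vof w) t| <= e / 2.
Proof.
move=> gv gw e0 vw t td; apply: norm_le_coord => [|k i]; first exact: divr_ge0.
rewrite (ord1 k) coordB.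
have gV := good_vof gv; have gW := good_vof gw.
have cV := continuous_xof gV; have cW := continuous_xof gW.
have cgV := continuous_vof gv; have cgW := continuous_vof gw.
have MV := vof_le gv; have MW := vof_le gw.
have dV s (sd : 0 < s < d) := is_derive_xof gV i sd.
have dW s (sd : 0 < s < d) := is_derive_xof gW i sd.
have V0 := xof0 (vof v); have W0' := xof0 (vof w).
have IV s (s0 : 0 < s) := integrable_kernel_good gV i s0.
have IW s (s0 : 0 < s) := integrable_kernel_good gW i s0.
have CV s (sd : 0 < s < d) := caputo_xof_vof gv i sd.
have CW s (sd : 0 < s < d) := caputo_xof_vof gw i sd.
have fle s : 0 < s < d -> `|f (xof v s) ord0 i - f (xof w s) ord0 i| <= n%:R * b * e.
  move=> /andP[s0 sd]; rewrite -coordB (le_trans (norm_coord_le _ _ _))//.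
  apply: le_trans (lipschitz_of_jacobian df b0 Jb (xof_ball gv s) (xof_ball gw s)) _.
  by rewrite ler_wpM2l ?mulr_ge0// vw// ltW.
(* Only the facts just collected are used from here on, so the iterates become arbitrary
   functions. *)
move: (vof v) (vof w) (xof (vof v)) (xof (vof w)) cV cW cgV cgW MV MW dV dW V0 W0' IV IW CV CW => g h x y.
move=> cx cy cg ch gM hM dx dy x0 y0 ig ih Cg Ch.
apply: (@le_trans _ _ (d `^ alpha * (G * (n%:R * b * e)))); last first.
  rewrite (_ : d `^ alpha * _ = d `^ alpha * (G * (n%:R * b)) * e); last by ring.
  by rewrite [leRHS]mulrC ler_wpM2r.
apply: (@norm_le_of_caputo_le _ alpha d (M + M) _ (fun s => x s ord0 i - y s ord0 i)
  (fun s => g s ord0 i - h s ord0 i)) => //.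
- by move=> s; apply: continuousB; apply: continuous_coord.
- by rewrite x0 y0 subrr.
- by move=> s; apply: continuousB; apply: continuous_coord.
- move=> s; rewrite (le_trans (ler_normB _ _))// lerD//.
    by rewrite (le_trans (norm_coord_le _ _ _)).
  by rewrite (le_trans (norm_coord_le _ _ _)).
- by move=> s sd; rewrite mulrBr; apply: is_deriveB; [exact: dx|exact: dy].
move=> s sd; have /andP[s0 _] := sd.
rewrite (_ : Rintegral _ _ _ = G * (f (xof v s) ord0 i - f (xof w s) ord0 i)).
  by rewrite normrM (gtr0_norm G0) ler_pM2l// fle.
rewrite mulrBr -Cg// -Ch// -RintegralB//; try by [exact: ig|exact: ih].
by apply: eq_Rintegral => r _; rewrite !mulrBr.
Qed.

(** hof v - hof w = (v - w) Df(xof v) + w (Df(xof v) - Df(xof w)). The first term contributes at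
    most a / 2 by [d2]; the second is small by uniform continuity of Df on the unit ball, once the
    x's are [eta]-close. *)
Lemma vof_dist e : 0 < e -> exists2 eta, 0 < eta &
  forall v w a, good v -> good w -> 0 <= a ->
    (forall t, `|v t - w t| <= a) ->
    (forall s, 0 <= s < d -> `|xof v s - xof w s| < eta) ->
    forall t, `|vof v t - vof w t| <= a / 2 + e.
Proof.
move=> e0; pose K := kap * d `^ alpha * W * n%:R * M.
have kW0 : 0 <= kap * d `^ alpha * W * n%:R.
  exact: (mulr_ge0 (mulr_ge0 (mulr_ge0 (ltW kap0) (powR_ge0 _ _)) (ltW W0)) (ler0n _ _)).
have K0 : 0 <= K := mulr_ge0 kW0 M0.
(* The second term will be multiplied by [K], and K e / (K + 1) <= e. *)
have eK : 0 < e / (K + 1) by rewrite divr_gt0// ltr_wpDl.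
have [eta eta0 Jeta] := compact_uniformly_continuous (compact_ball_rV (X := X0) (r := 1))
  (proj2 C1f) eK.
exists eta => // v w a gv gw a0' vw xvw t.
apply: norm_le_coord => [|k i]; first by rewrite addr_ge0 ?divr_ge0 ?(ltW e0).
rewrite (ord1 k) coordB !vofE.
have hvw s j : 0 <= s < d ->
    `|(hof v s - hof w s) ord0 j| <= n%:R * (a * b) + n%:R * (M * (e / (K + 1))).
  move=> sd; rewrite (_ : hof v s - hof w s = (v s - w s) *m 'J f (xof v s) +
      w s *m ('J f (xof v s) - 'J f (xof w s))); last first.
    by rewrite !hofE mulmxBl mulmxBr addrA subrK.
  rewrite mxE (le_trans (ler_normD _ _))// lerD//; apply: norm_mulmx_coord_le => //.
  - exact: Jb (xof_ball gv s).
  - by case: gw.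
  - move=> l k'; rewrite (le_trans (norm_coord_le _ _ _))// Jeta//; last exact: xvw.
    exact: xof_ball.
have chB : continuous (fun s => hof v s - hof w s).
  by move=> s; apply: continuousB; exact: continuous_hof.
have -> : kap * (f X0 ord0 i + c t `^ alpha * avg (hof v) (c t) ord0 i) -
    kap * (f X0 ord0 i + c t `^ alpha * avg (hof w) (c t) ord0 i) =
    kap * (c t `^ alpha * avg (fun s => hof v s - hof w s) (c t) ord0 i).
  rewrite -mulrBr opprD addrACA subrr add0r -mulrBr; congr (_ * (_ * _)).
  rewrite !avgE -RintegralB//.
  - by apply: eq_Rintegral => r _; rewrite coordB mulrBr.
  - exact: integrable_avg.
  - exact: integrable_avg.
rewrite normrM (gtr0_norm kap0) normrM (ger0_norm (powR_ge0 _ _)).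
apply: (@le_trans _ _ (kap * (d `^ alpha *
   ((n%:R * (a * b) + n%:R * (M * (e / (K + 1)))) * W)))).
  rewrite ler_pM2l// ler_pM ?powR_ge0//.
  exact: (norm_avg_le t chB hvw).
rewrite (_ : kap * _ = kap * d `^ alpha * W * n%:R * b * a + K * (e / (K + 1))); last first.
  by rewrite /K; ring.
apply: lerD; last first.
  rewrite mulrCA -[leRHS]mulr1 ler_pM2l// ler_pdivrMr ?ltr_wpDl// mul1r; lra.
rewrite [leRHS]mulrC ler_wpM2r//; apply: le_trans d2.
rewrite -[leRHS]mulrA [M * b]mulrC mulrA ler_peMr//.
by rewrite mulr_ge0.
Qed.

(** This transfers the convergence of the v's to the x's when passing to the limit in the
    iteration. *)
Lemma xof_dist v w a : good v -> good w -> (forall t, `|v t - w t| <= a) ->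
  forall t, `|xof v t - xof w t| <= a * (d `^ alpha / alpha).
Proof.
move=> gv gw vw t.
have a0' : 0 <= a by apply: le_trans (vw 0).
apply: norm_le_coord => [|k i]; first by rewrite mulr_ge0 ?divr_ge0 ?powR_ge0 ?(ltW a0).
rewrite (ord1 k) coordB !xofE opprD addrACA subrr add0r.
have cvi : continuous (fun s => v s ord0 i) by apply: continuous_coord; case: gv.
have cwi : continuous (fun s => w s ord0 i) by apply: continuous_coord; case: gw.
have vM s : `|v s ord0 i| <= M by apply: le_trans (norm_coord_le _ _ _) _; case: gv.
have wM s : `|w s ord0 i| <= M by apply: le_trans (norm_coord_le _ _ _) _; case: gw.
have /andP[ct0 _] := c0d t.
rewrite (wprimB qq ct0 cvi vM cwi wM).
have cB : continuous (fun s => v s ord0 i - w s ord0 i).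
  by move=> s; apply: continuousB; [exact: cvi|exact: cwi].
have Ba s : `|v s ord0 i - w s ord0 i| <= a.
  by rewrite -coordB (le_trans (norm_coord_le _ _ _)).
apply: le_trans (norm_wprim_le qq cB Ba ct0) _.
by rewrite q1E ler_wpM2l// ler_pM2r ?invr_gt0.
Qed.

Lemma vof_fixed_point : exists2 v, good v & vof v = v.
Proof.
pose u k := iter k vof (cst 0).
have gu k : good (u k).
  elim: k => [|k ih]; last exact: good_vof.
  by split => [|t]; [exact: cst_continuous|rewrite normr0].
have x_cauchy m k l : (m <= k)%N -> (m <= l)%N ->
    forall s, 0 <= s < d -> `|xof (u k) s - xof (u l) s| <= 2 * 2^-1 ^+ m.
  elim: m k l => [|m ih] k l mk ml s sd.
    have := xof_ball (gu k) s; have := xof_ball (gu l) s.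
    move: (xof (u k) s) (xof (u l) s) => y z zX yX.
    rewrite expr0 mulr1 -[y](subrK X0) -addrA (le_trans (ler_normD _ _))//.
    by rewrite (distrC X0); lra.
  case: k mk => // k mk; case: l ml => // l ml.
  rewrite exprS mulrCA mulrC; apply: xof_contraction => //.
  exact: ih.
have u_cauchy : uniformly_cauchy u.
  move=> e e0; have e4 : 0 < e / 4 by lra.
  have [eta eta0 Veta] := vof_dist e4.
  have [N0 N0eta] := half_exp_small 2 (divr_gt0 eta0 (ltr0Sn _ 1)).
  (* From index N0 on the x's are [eta]-close, so each iteration sends a bound B to B / 2 + e / 4.
     The affine map has fixed point e / 2, and the initial excess is covered by 2 M, the diameter
     bound for good functions. *)
  have claim m k l : (N0.+1 + m <= k)%N -> (N0.+1 + m <= l)%N ->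
      forall t, `|u k t - u l t| <= 2 * M * 2^-1 ^+ m + e / 2.
    elim: m k l => [|m ih] k l mk ml t.
      rewrite expr0 mulr1 (le_trans (ler_normB _ _))//.
      have [_ /(_ t) ukM] := gu k; have [_ /(_ t) ulM] := gu l.
      lra.
    case: k mk => // k; rewrite addnS ltnS => mk; case: l ml => // l; rewrite addnS ltnS => ml.
    rewrite (_ : _ + e / 2 = (2 * M * 2^-1 ^+ m + e / 2) / 2 + e / 4); last first.
      by rewrite exprS; field.
    apply: Veta => //.
    - by rewrite addr_ge0 ?divr_ge0 ?(ltW e0)// !mulr_ge0// exprn_ge0// invr_ge0.
    - exact: ih.
    - move=> s sd; rewrite (le_lt_trans (x_cauchy N0 k l _ _ s sd))//; last lra.
        by apply: leq_trans mk; rewrite addSn -addnS leq_addr.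
      by apply: leq_trans ml; rewrite addSn -addnS leq_addr.
  have [N1 N1e] := half_exp_small (2 * M) (divr_gt0 e0 (ltr0Sn _ 1)).
  exists (N0.+1 + N1)%N => k l Nk Nl t.
  by rewrite (le_trans (claim N1 k l Nk Nl t))//; lra.
have [v uv] := uniformly_cauchy_converges u_cauchy.
have gv : good v.
  split; first by apply: continuous_uniform_limit uv => k; case: (gu k).
  move=> t; rewrite -[v t]subr0; apply: uniform_limit_ball uv _ => k.
  by rewrite subr0; case: (gu k).
exists v => //; apply/funext => t; apply/eqP; rewrite eq_sym -subr_eq0 -normr_le0.
apply/ler_addgt0Pr => e e0; rewrite add0r.
have e3 : 0 < e / 3 by lra.
have [eta eta0 Veta] := vof_dist e3.
pose D := d `^ alpha / alpha.
have D0 : 0 < D by rewrite divr_gt0// powR_gt0.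
(* Small enough that a D < eta, so that [Veta] applies, and that a + a / 2 + e / 3 <= e. *)
pose a := Num.min (e / 3) (eta / 2 / D).
have a0' : 0 < a by rewrite lt_min e3; exact: (divr_gt0 (divr_gt0 eta0 (ltr0Sn _ 1)) D0).
have [N uN] := uv a a0'.
have ae : a <= e / 3 by rewrite ge_min lexx.
have aeta : a * D < eta.
  rewrite (@le_lt_trans _ _ (eta / 2))//; last lra.
  by rewrite -ler_pdivlMr// ge_min lexx orbT.
have vu : `|v t - u N.+1 t| <= a by rewrite distrC uN.
have uu : `|u N.+1 t - vof v t| <= a / 2 + e / 3.
  apply: Veta => //; first exact: ltW; first exact: uN.
  by move=> s _; apply: le_lt_trans (xof_dist (gu N) gv (uN N (leqnn _)) s) aeta.
rewrite -[v t](subrK (u N.+1 t)) -addrA (le_trans (ler_normD _ _))//.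
lra.
Qed.

(** At a fixed point the next x and the current x coincide, so [caputo_xof_vof] becomes the
    fractional equation. *)
Lemma fractional_solution_of_fixed_point v : good v -> vof v = v ->
  fractional_solution alpha f d%:E (xof v).
Proof.
move=> gv vE; split; first by rewrite lte_fin.
  by apply: continuous_subspaceT; exact: continuous_xof.
move=> t t0; rewrite lte_fin => td i.
have ttd : 0 < t < d by rewrite t0.
have dE s : 0 < s < d -> derive1 (coordinate (xof v) i) s = s `^ q * v s ord0 i.
  by move=> sd; rewrite derive1E; have [_ ->] := is_derive_xof gv i sd.
have eqD s : s \in `]0, t[ ->
    (t - s) `^ p * (s `^ q * v s ord0 i) = caputo_integrand alpha (coordinate (xof v) i) t s.
  rewrite in_itv/= => /andP[s0 st]; rewrite /caputo_integrand dE// s0.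
  exact: lt_trans td.
split.
- by have [] := is_derive_xof gv i ttd.
- have : (s `^ q * v s ord0 i) @[s --> t] --> derive1 (coordinate (xof v) i) t.
    rewrite dE//; apply: cvgM.
      by have [/derivable1_diffP/differentiable_continuous + _] := is_derive1_powR q t0.
    by apply: continuous_coord; case: gv.
  apply: cvg_trans; apply: near_eq_cvg.
  have : t \in `]0, d[ by rewrite in_itv.
  by move=> /near_in_itvoo; apply: filterS => s; rewrite in_itv/= => /dE.
- have := integrable_kernel_good gv i t0.
  by apply: eq_integrable => // s; rewrite inE => /eqD /= ->.
- rewrite /caputo -(_ : \int[mu]_(s in `]0, t[) ((t - s) `^ p * (s `^ q * v s ord0 i)) =
      \int[mu]_(s in `]0, t[) caputo_integrand alpha (coordinate (xof v) i) t s); last first.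
    by apply: eq_Rintegral => s; rewrite inE => /eqD.
  have := caputo_xof_vof gv i ttd; rewrite vE => ->.
  by rewrite mulKf// gt_eqF.
Qed.

End fractional_existence.

(** * Invariance implies tangency *)

Section equivalence.
Context {R : realType}.
Notation mu := (@lebesgue_measure R).

Lemma fractional_existence n alpha (f : 'rV[R]_n -> 'rV[R]_n) X0 :
  0 < alpha < 1 -> of_class_C1 f ->
  exists2 d, 0 < d & exists2 x : R -> 'rV[R]_n, continuous x &
    x 0 = X0 /\ fractional_solution alpha f d%:E x.
Proof.
move=> a01 C1f; have [b b0 Jb] := C1_jacobian_bounded X0 1 C1f.
have /andP[a0 a1] := a01.
have pp : -1 < - alpha <= 0 by lra.
have qq : -1 < alpha - 1 <= 0 by lra.
have G0 : 0 <= Gamma (1 - alpha) by apply/ltW/Gamma_gt0; lra.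
have W0 : 0 <= Beta (alpha - 1) (alpha - 1) by exact/ltW/Beta_gt0.
have k0 : 0 <= Gamma (1 - alpha) / Beta (- alpha) (alpha - 1).
  by rewrite divr_ge0//; exact/ltW/Beta_gt0.
have M0 : 0 <= Gamma (1 - alpha) / Beta (- alpha) (alpha - 1) * `|f X0| + 1.
  by rewrite addr_ge0// mulr_ge0.
have [A A0 AE] : exists2 A, 0 <= A & A = (Gamma (1 - alpha) / Beta (- alpha) (alpha - 1) * `|f X0| + 1) / alpha.
  by eexists; last reflexivity; rewrite divr_ge0// ltW.
have [B B0 BE] : exists2 B, 0 <= B & B = Gamma (1 - alpha) / Beta (- alpha) (alpha - 1) *
    Beta (alpha - 1) (alpha - 1) * n%:R *
    (Gamma (1 - alpha) / Beta (- alpha) (alpha - 1) * `|f X0| + 1) * b.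
  by eexists; last reflexivity; do 4![apply: mulr_ge0 => //].
have [D D0 DE] : exists2 D, 0 <= D & D = Gamma (1 - alpha) * (n%:R * b).
  by eexists; last reflexivity; do 2![apply: mulr_ge0 => //].
(* With d^alpha = 1 / C the three smallness conditions read A <= C, 2 B <= C and 2 D <= C; the
   summand 1 makes C positive. *)
pose C := A + 2 * B + 2 * D + 1.
have C0 : 0 < C by rewrite /C; lra.
pose d := C^-1 `^ alpha^-1.
have d0 : 0 < d by rewrite powR_gt0// invr_gt0.
have dE : d `^ alpha = C^-1.
  by rewrite /d -powRrM mulVf ?gt_eqF// powRr1// invr_ge0 ltW.
have d1 : (Gamma (1 - alpha) / Beta (- alpha) (alpha - 1) * `|f X0| + 1) *
    (d `^ alpha / alpha) <= 1.
  rewrite mulrCA -AE dE mulrC ler_pdivrMr// /C; lra.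
have d2 : Gamma (1 - alpha) / Beta (- alpha) (alpha - 1) * d `^ alpha *
    Beta (alpha - 1) (alpha - 1) * n%:R *
    (Gamma (1 - alpha) / Beta (- alpha) (alpha - 1) * `|f X0| + 1) * b <= 2^-1.
  rewrite [leLHS](_ : _ = B * d `^ alpha); last by rewrite BE; ring.
  by rewrite dE ler_pdivrMr// /C; lra.
have d3 : d `^ alpha * (Gamma (1 - alpha) * (n%:R * b)) <= 2^-1.
  by rewrite -DE dE mulrC ler_pdivrMr// /C; lra.
have [v gv vE] := vof_fixed_point a01 C1f b0 d0 Jb d1 d2 d3.
exists d => //; exists (xof alpha X0 d v).
  exact: (continuous_xof a01 gv).
split; first exact: xof0.
exact: (fractional_solution_of_fixed_point a01 C1f d0 Jb d1 d2 gv vE).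
Qed.

(** Since a.x is constant, the Caputo integral of a.x vanishes and a.f(x(t)) = 0 for 0 < t < d. The
    equation is not imposed at t = 0, so a.f(X0) = 0 is obtained as a limit from the right. *)
Lemma tangent_of_fractional_invariant n alpha (f : 'rV[R]_n -> 'rV[R]_n) a c :
  0 < alpha < 1 -> of_class_C1 f ->
  fractional_invariant alpha f [set x | dot a x = c] -> tangent f a c.
Proof.
move=> a01 C1f inv X0 SX0.
have G0 : 0 < Gamma (1 - alpha) by apply: Gamma_gt0; lra.
have [d d0 [x cx [x0 solx]]] := fractional_existence X0 a01 C1f.
have Sx t : 0 <= t < d -> dot a (x t) - c = 0.
  move=> /andP[t0 td]; apply/eqP; rewrite subr_eq0; apply/eqP.
  by apply: (inv X0 d%:E x SX0 solx x0 t t0); rewrite lte_fin.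
have dx t : 0 < t < d -> \sum_(i < n) a i * derive1 (coordinate x i) t = 0.
  move=> /andP[t0 td]; have [_ _ /(_ t t0)] := solx; rewrite lte_fin => /(_ td) solt.
  have h : is_derive t 1 (fun s => dot a (x s) - c)
      (\sum_(i < n) a i * derive1 (coordinate x i) t).
    apply: is_derive_dot => i; have [+ _ _ _] := solt i.
    by rewrite derive1E; exact: derivableP.
  have /@derive_val <- := h.
  rewrite -[RHS](derive_cst (0 : R) t 1); apply: near_eq_derive.
  have : t \in `]0, d[ by rewrite in_itv/= t0.
  by move=> /near_in_itvoo; apply: filterS => z; rewrite in_itv/= => zd; apply: Sx; lra.
have fx t : 0 < t < d -> dot a (f (x t)) = 0.
  move=> td; have /andP[t0 tltd] := td.
  have [_] := fractional_solution_dot a G0 solx t0 (ltac:(by rewrite lte_fin)).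
  rewrite (_ : Rintegral _ _ _ = 0).
    by move/eqP; rewrite eq_sym mulf_eq0 gt_eqF//= => /eqP.
  transitivity (\int[mu]_(s in `]0, t[) (0 : R)); last by rewrite Rintegral_cst// mul0r.
  apply: eq_Rintegral => s; rewrite inE/= in_itv/= => /andP[s0 st].
  by rewrite dx ?mulr0// s0 (lt_trans st).
have cfx : dot a (f (x t)) @[t --> (0 : R)^'+] --> dot a (f (x 0)).
  apply: cvg_at_right_filter.
  apply: (@continuous_comp _ _ _ (f \o x) (dot a)); last exact: continuous_dot.
  apply: continuous_comp; first exact: cx.
  by apply: differentiable_continuous; case: C1f.
rewrite -x0; transitivity (lim (dot a (f (x t)) @[t --> (0 : R)^'+])).
  by apply/esym/cvg_lim.
apply/cvg_lim => //.
have : (fun=> 0 : R) @ (0 : R)^'+ --> (0 : R) by exact: cvg_cst.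
apply: cvg_trans; apply: near_eq_cvg; near=> t.
rewrite fx//; apply/andP; split.
  by near: t; exact: nbhs_right_gt.
by near: t; exact: nbhs_right_lt.
Unshelve. all: by end_near. Qed.
End equivalence.

Theorem theorem4p1 (R : realType) (n : nat) (alpha : R)
    (halpha0 : 0 < alpha) (halpha1 : alpha < 1)
    (f : 'rV[R]_n -> 'rV[R]_n) (hf : of_class_C1 f)
    (S : set 'rV[R]_n) (hS : linear_subspace S) :
  fractional_invariant alpha f S <-> classical_invariant f S.
Proof.
have a01 : 0 < alpha < 1 by rewrite halpha0.
have [a [c ->]] := hS; split => inv.
  apply: classical_invariant_of_tangent => //.
  exact: tangent_of_fractional_invariant inv.
apply: fractional_invariant_of_tangent => //; first by apply: Gamma_gt0; lra.
exact: tangent_of_classical_invariant.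
Qed.
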